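(* Let $\mathsf{C}$ be a strict braided monoidal category. The category $\mathsf{GIC}$ of generalized invertible 1-cocycles in $\mathsf{C}$ and the category $\mathsf{HTr}$ of Hopf trusses in $\mathsf{C}$ are equivalent.
   Context: **Conventions.** $(\mathsf{C},\otimes,K,c)$ is a strict braided monoidal category with unit object $K$ and braiding $c$. For an object $P$ and a morphism $f$, $P\otimes f$ and $f\otimes P$ mean $id_P\otimes f$ and $f\otimes id_P$. Monoids $(A,\eta_A,\mu_A)$ (unit, product) and comonoids $(D,\varepsilon_D,\delta_D)$ (counit, coproduct) and their morphisms are the usual (co)associative (co)unital ones. For comonoids $D,E$, $D\otimes E$ is a comonoid with $\varepsilon_{D\otimes E}=\varepsilon_D\otimes\varepsilon_E$, $\delta_{D\otimes E}=(D\otimes c_{D,E}\otimes E)\circ(\delta_D\otimes\delta_E)$. **Bimonoids, Hopf monoids.** A non-unital bimonoid is a comonoid $(B,\varepsilon_B,\delta_B)$ with an associative product $\mu_B:B\otimes B\to B$ (no unit required) that is a comonoid morphism; morphisms of non-unital bimonoids are multiplicative comonoid morphisms. A bimonoid is an object that is a monoid and a comonoid such that unit and product are comonoid morphisms; a Hopf monoid is a bimonoid $H$ with an antipode $\lambda_H:H\to H$, i.e. $\mu_H\circ(H\otimes\lambda_H)\circ\delta_H=\eta_H\circ\varepsilon_H=\mu_H\circ(\lambda_H\otimes H)\circ\delta_H$. Morphisms of Hopf monoids are morphisms of monoids and comonoids. **Hopf trusses.** A Hopf truss $\mathbb{H}=(H_1,H_2,\sigma_H)$ in $\mathsf{C}$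 consists of a comonoid $(H,\varepsilon_H,\delta_H)$ together with $\eta_H,\mu_H^1,\mu_H^2,\lambda_H,\sigma_H$ such that $H_1=(H,\eta_H,\mu_H^1,\varepsilon_H,\delta_H,\lambda_H)$ is a Hopf monoid, $H_2=(H,\mu_H^2,\varepsilon_H,\delta_H)$ is a non-unital bimonoid, $\sigma_H:H\to H$ is a comonoid morphism, and $$\mu_H^2\circ(H\otimes\mu_H^1)=\mu_H^1\circ(\mu_H^2\otimes\Gamma_{H_1}^{\sigma_H})\circ(H\otimes c_{H,H}\otimes H)\circ(\delta_H\otimes H\otimes H),$$ where $\Gamma_{H_1}^{\sigma_H}=\mu_H^1\circ((\lambda_H\circ\sigma_H)\otimes\mu_H^2)\circ(\delta_H\otimes H)$. A morphism of Hopf trusses $\mathbb{H}\to\mathbb{B}$ is a morphism $f:H\to B$ that is a Hopf monoid morphism $H_1\to B_1$ and a non-unital bimonoid morphism $H_2\to B_2$. These form the category $\mathsf{HTr}$. **Non-unital module monoids.** For a non-unital bimonoid $B$, a non-unital left $B$-module is a pair $(M,\phi_M)$ with $\phi_M:B\otimes M\to M$ satisfying $\phi_M\circ(B\otimes\phi_M)=\phi_M\circ(\mu_B\otimes M)$. A monoid $A$ with $\phi_A:B\otimes A\to A$ is a non-unital left $B$-module monoid if $(A,\phi_A)$ is a non-unital left $B$-module, $\phi_A\circ(B\otimes\eta_A)=\varepsilon_B\otimes\eta_A$, and $\phi_A\circ(B\otimes\mu_A)=\mu_A\circ(\phi_A\otimes\phi_A)\circ(B\otimes c_{B,A}\otimes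 A)\circ(\delta_B\otimes A\otimes A)$. **Generalized invertible 1-cocycles.** Let $H$ be a Hopf monoid, $B$ a non-unital bimonoid, and suppose $H$ is a non-unital left $B$-module monoid with action $\phi_H$. A comonoid morphism $\pi:B\to H$ is a generalized invertible 1-cocycle if it is an isomorphism and there is a comonoid endomorphism $\theta_\pi:B\to B$ with $$\pi\circ\mu_B=\mu_H\circ((\pi\circ\theta_\pi)\otimes\phi_H)\circ(\delta_B\otimes\pi).$$ An object of $\mathsf{GIC}$ is such a $\pi$ together with $\theta_\pi$ (and $\phi_H$), written $(\pi:B\to H,\theta_\pi)$. A morphism from $(\pi:B\to H,\theta_\pi)$ to $(\pi':B'\to H',\theta_{\pi'})$ is a pair $(f,g)$ with $f:B\to B'$ a morphism of non-unital bimonoids and $g:H\to H'$ a morphism of Hopf monoids such that $f\circ\theta_\pi=\theta_{\pi'}\circ f$, $g\circ\pi=\pi'\circ f$ and $g\circ\phi_H=\phi_{H'}\circ(f\otimes g)$. *)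

(* Defs.v *)
From Stdlib Require Import ProofIrrelevance.

Set Implicit Arguments.
Unset Strict Implicit.
Unset Printing Implicit Defensive.

Declare Scope cat_scope.
Delimit Scope cat_scope with cat.
Local Open Scope cat_scope.

(** * Categories, functors, equivalences *)

Structure category := Category {
  obj :> Type;
  hom : obj -> obj -> Type;
  idm : forall X, hom X X;
  comp : forall X Y Z, hom Y Z -> hom X Y -> hom X Z;
  comp_idl : forall X Y (f : hom X Y), comp (idm Y) f = f;
  comp_idr : forall X Y (f : hom X Y), comp f (idm X) = f;
  comp_assoc : forall W X Y Z (h : hom Y Z) (g : hom X Y) (f : hom W X),
    comp h (comp g f) = comp (comp h g) f
}.

Arguments hom {c} _ _.
Arguments idm {c} _.
Arguments comp {c X Y Z} _ _.

Notation "g ∘ f" := (comp g f) (at level 40, left associativity) : cat_scope.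

Definition is_iso (C : category) (X Y : C) (f : hom X Y) : Prop :=
  exists g : hom Y X, g ∘ f = idm X /\ f ∘ g = idm Y.

Structure functor (C D : category) := Functor {
  fobj :> C -> D;
  fmap : forall X Y : C, hom X Y -> hom (fobj X) (fobj Y);
  fmap_id : forall X : C, fmap (idm X) = idm (fobj X);
  fmap_comp : forall (X Y Z : C) (g : hom Y Z) (f : hom X Y),
    fmap (g ∘ f) = fmap g ∘ fmap f
}.

Arguments fmap {C D} _ {X Y} _.

Definition id_functor (C : category) : functor C C :=
  @Functor C C (fun X => X) (fun X Y f => f)
    (fun X => eq_refl) (fun X Y Z g f => eq_refl).

Lemma comp_functor_id (C D E : category) (G : functor D E) (F : functor C D)
    (X : C) : fmap G (fmap F (idm X)) = idm (G (F X)).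
Proof. now rewrite !fmap_id. Qed.

Lemma comp_functor_comp (C D E : category) (G : functor D E) (F : functor C D)
    (X Y Z : C) (g : hom Y Z) (f : hom X Y) :
  fmap G (fmap F (g ∘ f)) = fmap G (fmap F g) ∘ fmap G (fmap F f).
Proof. now rewrite !fmap_comp. Qed.

Definition comp_functor (C D E : category) (G : functor D E) (F : functor C D) :
    functor C E :=
  @Functor C E (fun X => G (F X)) (fun X Y f => fmap G (fmap F f))
    (comp_functor_id G F) (@comp_functor_comp C D E G F).

Definition naturally_isomorphic (C D : category) (F G : functor C D) : Prop :=
  exists t : forall X : C, hom (F X) (G X),
    (forall X, is_iso (t X)) /\
    (forall (X Y : C) (f : hom X Y), t Y ∘ fmap F f = fmap G f ∘ t X).

Definition equivalent_categories (C D : category) : Prop :=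
  exists (F : functor C D) (G : functor D C),
    naturally_isomorphic (comp_functor G F) (id_functor C) /\
    naturally_isomorphic (comp_functor F G) (id_functor D).

(** * Strict braided monoidal categories

    In a strict monoidal category the tensor product is associative and unital
    on the nose.  On objects these are the equations [tensA], [tens1l],
    [tens1r]; they are not definitional, so wherever a formula silently
    identifies, say, [(X ⊗ Y) ⊗ Z] with [X ⊗ (Y ⊗ Z)], the identity morphism
    transported along the object equation, [eqm], has to be inserted.
    The pentagon and the triangle hold automatically, since all their edges are
    of the form [eqm _] and equality proofs are unique (proof irrelevance). *)

Definition eqm (C : category) (X Y : C) (e : X = Y) : hom X Y :=
  match e in _ = Z return hom X Z with eq_refl => idm X end.

Structure strict_monoidal_category := StrictMonoidalCategory {
  smc_cat :> category;
  tens : smc_cat -> smc_cat -> smc_cat;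
  unit_obj : smc_cat;
  tensm : forall X X' Y Y' : smc_cat,
    hom X X' -> hom Y Y' -> hom (tens X Y) (tens X' Y');
  tensm_id : forall X Y : smc_cat, tensm (idm X) (idm Y) = idm (tens X Y);
  tensm_comp : forall (X X' X'' Y Y' Y'' : smc_cat)
      (f' : hom X' X'') (f : hom X X') (g' : hom Y' Y'') (g : hom Y Y'),
    tensm (f' ∘ f) (g' ∘ g) = tensm f' g' ∘ tensm f g;
  tensA : forall X Y Z : smc_cat, tens (tens X Y) Z = tens X (tens Y Z);
  tens1l : forall X : smc_cat, tens unit_obj X = X;
  tens1r : forall X : smc_cat, tens X unit_obj = X;
  tensmA : forall (X X' Y Y' Z Z' : smc_cat)
      (f : hom X X') (g : hom Y Y') (h : hom Z Z'),
    eqm (tensA X' Y' Z') ∘ tensm (tensm f g) h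
      = tensm f (tensm g h) ∘ eqm (tensA X Y Z);
  tensm1l : forall (X X' : smc_cat) (f : hom X X'),
    eqm (tens1l X') ∘ tensm (idm unit_obj) f = f ∘ eqm (tens1l X);
  tensm1r : forall (X X' : smc_cat) (f : hom X X'),
    eqm (tens1r X') ∘ tensm f (idm unit_obj) = f ∘ eqm (tens1r X)
}.

Arguments tens {s} _ _.
Arguments unit_obj {s}.
Arguments tensm {s X X' Y Y'} _ _.
Arguments tensA {s} _ _ _.
Arguments tens1l {s} _.
Arguments tens1r {s} _.

Notation "X ⊗ Y" := (tens X Y) (at level 35, right associativity) : cat_scope.
Notation "f ⊗m g" := (tensm f g) (at level 35, right associativity) : cat_scope.

Section StrictIdentifications.
Variable C : strict_monoidal_category.
Implicit Types X Y Z : C.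

Definition assoc X Y Z : hom ((X ⊗ Y) ⊗ Z) (X ⊗ (Y ⊗ Z)) := eqm (tensA X Y Z).
Definition assoc_inv X Y Z : hom (X ⊗ (Y ⊗ Z)) ((X ⊗ Y) ⊗ Z) :=
  eqm (eq_sym (tensA X Y Z)).
Definition unitl X : hom (unit_obj ⊗ X) X := eqm (tens1l X).
Definition unitr X : hom (X ⊗ unit_obj) X := eqm (tens1r X).
Definition unitl_inv X : hom X (unit_obj ⊗ X) := eqm (eq_sym (tens1l X)).

Lemma tens_mid (W X Y Z : C) : (W ⊗ X) ⊗ (Y ⊗ Z) = (W ⊗ (X ⊗ Y)) ⊗ Z.
Proof. now rewrite <- (tensA (W ⊗ X) Y Z), (tensA W X Y). Qed.

End StrictIdentifications.

Structure strict_braided_monoidal_category := StrictBraidedMonoidalCategory {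
  sbc_smc :> strict_monoidal_category;
  braid : forall X Y : sbc_smc, hom (X ⊗ Y) (Y ⊗ X);
  braid_iso : forall X Y : sbc_smc, is_iso (braid X Y);
  braid_natural : forall (X X' Y Y' : sbc_smc) (f : hom X X') (g : hom Y Y'),
    braid X' Y' ∘ (f ⊗m g) = (g ⊗m f) ∘ braid X Y;
  braid_tensr : forall X Y Z : sbc_smc,
    assoc Y Z X ∘ braid X (Y ⊗ Z) ∘ assoc X Y Z
      = (idm Y ⊗m braid X Z) ∘ assoc Y X Z ∘ (braid X Y ⊗m idm Z);
  braid_tensl : forall X Y Z : sbc_smc,
    assoc_inv Z X Y ∘ braid (X ⊗ Y) Z ∘ assoc_inv X Y Z
      = (braid X Z ⊗m idm Y) ∘ assoc_inv X Z Y ∘ (idm X ⊗m braid Y Z)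
}.

Arguments braid {s} _ _.

Section BraidedAlgebra.
Variable C : strict_braided_monoidal_category.

(** [W ⊗ c ⊗ Z], up to the strict identifications. *)
Definition mid_braid (W X Y Z : C) : hom ((W ⊗ X) ⊗ (Y ⊗ Z)) ((W ⊗ Y) ⊗ (X ⊗ Z)) :=
  eqm (eq_sym (tens_mid W Y X Z)) ∘ ((idm W ⊗m braid X Y) ⊗m idm Z)
    ∘ eqm (tens_mid W X Y Z).

(** * Monoids and comonoids *)

Structure monoid_ops (A : C) := MonoidOps {
  mon_unit : hom unit_obj A;
  mon_mul : hom (A ⊗ A) A
}.

Definition associative_product (A : C) (mul : hom (A ⊗ A) A) : Prop :=
  mul ∘ (idm A ⊗m mul) ∘ assoc A A A = mul ∘ (mul ⊗m idm A).

Definition is_monoid (A : C) (a : monoid_ops A) : Prop :=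
  associative_product (mon_mul a) /\
  mon_mul a ∘ (mon_unit a ⊗m idm A) = unitl A /\
  mon_mul a ∘ (idm A ⊗m mon_unit a) = unitr A.

Definition is_multiplicative (A B : C) (mulA : hom (A ⊗ A) A)
    (mulB : hom (B ⊗ B) B) (f : hom A B) : Prop :=
  f ∘ mulA = mulB ∘ (f ⊗m f).

Definition is_monoid_morphism (A B : C) (a : monoid_ops A) (b : monoid_ops B)
    (f : hom A B) : Prop :=
  f ∘ mon_unit a = mon_unit b /\ is_multiplicative (mon_mul a) (mon_mul b) f.

Structure comonoid_ops (D : C) := ComonoidOps {
  counit : hom D unit_obj;
  coprod : hom D (D ⊗ D)
}.

Definition is_comonoid (D : C) (d : comonoid_ops D) : Prop :=
  assoc D D D ∘ (coprod d ⊗m idm D) ∘ coprod d = (idm D ⊗m coprod d) ∘ coprod d /\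
  unitl D ∘ (counit d ⊗m idm D) ∘ coprod d = idm D /\
  unitr D ∘ (idm D ⊗m counit d) ∘ coprod d = idm D.

Definition is_comonoid_morphism (D E : C) (d : comonoid_ops D)
    (e : comonoid_ops E) (f : hom D E) : Prop :=
  counit e ∘ f = counit d /\ coprod e ∘ f = (f ⊗m f) ∘ coprod d.

Definition unit_comonoid : comonoid_ops (unit_obj : C) :=
  ComonoidOps (idm unit_obj) (unitl_inv unit_obj).

Definition tens_comonoid (D E : C) (d : comonoid_ops D) (e : comonoid_ops E) :
    comonoid_ops (D ⊗ E) :=
  ComonoidOps (unitl unit_obj ∘ (counit d ⊗m counit e))
              (mid_braid D D E E ∘ (coprod d ⊗m coprod e)).

(** * Bimonoids and Hopf monoids *)

Definition is_nonunital_bimonoid (B : C) (d : comonoid_ops B)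
    (mul : hom (B ⊗ B) B) : Prop :=
  is_comonoid d /\ associative_product mul /\
  is_comonoid_morphism (tens_comonoid d d) d mul.

Definition is_bimonoid (H : C) (a : monoid_ops H) (d : comonoid_ops H) : Prop :=
  is_monoid a /\ is_comonoid d /\
  is_comonoid_morphism unit_comonoid d (mon_unit a) /\
  is_comonoid_morphism (tens_comonoid d d) d (mon_mul a).

Definition is_antipode (H : C) (a : monoid_ops H) (d : comonoid_ops H)
    (S : hom H H) : Prop :=
  mon_mul a ∘ (idm H ⊗m S) ∘ coprod d = mon_unit a ∘ counit d /\
  mon_mul a ∘ (S ⊗m idm H) ∘ coprod d = mon_unit a ∘ counit d.

Definition is_hopf_monoid (H : C) (a : monoid_ops H) (d : comonoid_ops H)
    (S : hom H H) : Prop :=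
  is_bimonoid a d /\ is_antipode a d S.

Structure nonunital_bimonoid := NonunitalBimonoid {
  nb_obj :> C;
  nb_comonoid : comonoid_ops nb_obj;
  nb_mul : hom (nb_obj ⊗ nb_obj) nb_obj;
  nb_axioms : is_nonunital_bimonoid nb_comonoid nb_mul
}.

Structure hopf_monoid := HopfMonoid {
  hm_obj :> C;
  hm_monoid : monoid_ops hm_obj;
  hm_comonoid : comonoid_ops hm_obj;
  hm_antipode : hom hm_obj hm_obj;
  hm_axioms : is_hopf_monoid hm_monoid hm_comonoid hm_antipode
}.

Definition is_nonunital_bimonoid_morphism (B B' : nonunital_bimonoid)
    (f : hom B B') : Prop :=
  is_multiplicative (nb_mul B) (nb_mul B') f /\
  is_comonoid_morphism (nb_comonoid B) (nb_comonoid B') f.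

Definition is_hopf_morphism (H H' : hopf_monoid) (f : hom H H') : Prop :=
  is_monoid_morphism (hm_monoid H) (hm_monoid H') f /\
  is_comonoid_morphism (hm_comonoid H) (hm_comonoid H') f.

(** * Hopf trusses *)

(** The morphism [Γ], where [mul2] is the second product and [s] is [σ]. *)
Definition Gamma (H : C) (a : monoid_ops H) (mul2 : hom (H ⊗ H) H)
    (d : comonoid_ops H) (S s : hom H H) : hom (H ⊗ H) H :=
  mon_mul a ∘ ((S ∘ s) ⊗m mul2) ∘ assoc H H H ∘ (coprod d ⊗m idm H).

Structure hopf_truss := HopfTruss {
  ht_obj :> C;
  ht_comonoid : comonoid_ops ht_obj;
  ht_monoid : monoid_ops ht_obj;
  ht_mul2 : hom (ht_obj ⊗ ht_obj) ht_obj;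
  ht_antipode : hom ht_obj ht_obj;
  ht_sigma : hom ht_obj ht_obj;
  ht_axioms1 : is_hopf_monoid ht_monoid ht_comonoid ht_antipode;
  ht_axioms2 : is_nonunital_bimonoid ht_comonoid ht_mul2;
  ht_sigma_comonoid : is_comonoid_morphism ht_comonoid ht_comonoid ht_sigma;
  ht_compat :
    ht_mul2 ∘ (idm ht_obj ⊗m mon_mul ht_monoid)
      = mon_mul ht_monoid
          ∘ (ht_mul2 ⊗m Gamma ht_monoid ht_mul2 ht_comonoid ht_antipode ht_sigma)
          ∘ mid_braid ht_obj ht_obj ht_obj ht_obj
          ∘ (coprod ht_comonoid ⊗m idm (ht_obj ⊗ ht_obj))
}.

Definition ht_H1 (T : hopf_truss) : hopf_monoid := HopfMonoid (ht_axioms1 T).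
Definition ht_H2 (T : hopf_truss) : nonunital_bimonoid :=
  NonunitalBimonoid (ht_axioms2 T).

Definition is_hopf_truss_morphism (T T' : hopf_truss) (f : hom T T') : Prop :=
  @is_hopf_morphism (ht_H1 T) (ht_H1 T') f /\
  @is_nonunital_bimonoid_morphism (ht_H2 T) (ht_H2 T') f.

(** * Generalized invertible 1-cocycles *)

Definition is_nonunital_module (B : nonunital_bimonoid) (M : C)
    (phi : hom (B ⊗ M) M) : Prop :=
  phi ∘ (idm B ⊗m phi) ∘ assoc B B M = phi ∘ (nb_mul B ⊗m idm M).

Definition is_nonunital_module_monoid (B : nonunital_bimonoid) (A : C)
    (a : monoid_ops A) (phi : hom (B ⊗ A) A) : Prop :=
  is_nonunital_module phi /\
  phi ∘ (idm B ⊗m mon_unit a) = unitl A ∘ (counit (nb_comonoid B) ⊗m mon_unit a) /\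
  phi ∘ (idm B ⊗m mon_mul a)
    = mon_mul a ∘ (phi ⊗m phi) ∘ mid_braid B B A A
        ∘ (coprod (nb_comonoid B) ⊗m idm (A ⊗ A)).

Structure gen_inv_cocycle := GenInvCocycle {
  gic_B : nonunital_bimonoid;
  gic_H : hopf_monoid;
  gic_phi : hom (gic_B ⊗ gic_H) gic_H;
  gic_pi : hom gic_B gic_H;
  gic_theta : hom gic_B gic_B;
  gic_phi_module : is_nonunital_module_monoid (hm_monoid gic_H) gic_phi;
  gic_pi_comonoid :
    is_comonoid_morphism (nb_comonoid gic_B) (hm_comonoid gic_H) gic_pi;
  gic_pi_iso : is_iso gic_pi;
  gic_theta_comonoid :
    is_comonoid_morphism (nb_comonoid gic_B) (nb_comonoid gic_B) gic_theta;
  gic_cocycle :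
    gic_pi ∘ nb_mul gic_B
      = mon_mul (hm_monoid gic_H) ∘ ((gic_pi ∘ gic_theta) ⊗m gic_phi)
          ∘ assoc gic_B gic_B gic_H
          ∘ (coprod (nb_comonoid gic_B) ⊗m gic_pi)
}.

Definition is_gic_morphism (p p' : gen_inv_cocycle)
    (fg : hom (gic_B p) (gic_B p') * hom (gic_H p) (gic_H p')) : Prop :=
  let (f, g) := fg in
  is_nonunital_bimonoid_morphism f /\ is_hopf_morphism g /\
  f ∘ gic_theta p = gic_theta p' ∘ f /\
  g ∘ gic_pi p = gic_pi p' ∘ f /\
  g ∘ gic_phi p = gic_phi p' ∘ (f ⊗m g).

(** * The categories of Hopf trusses and of generalized invertible 1-cocycles *)

Lemma comonoid_morphism_id (D : C) (d : comonoid_ops D) :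
  is_comonoid_morphism d d (idm D).
Proof.
split; [apply comp_idr|].
now rewrite tensm_id, comp_idl, comp_idr.
Qed.

Lemma comonoid_morphism_comp (D E F : C) (d : comonoid_ops D)
    (e : comonoid_ops E) (f : comonoid_ops F) (v : hom E F) (u : hom D E) :
  is_comonoid_morphism e f v -> is_comonoid_morphism d e u ->
  is_comonoid_morphism d f (v ∘ u).
Proof.
intros [v0 v1] [u0 u1]; split.
- now rewrite comp_assoc, v0.
- now rewrite comp_assoc, v1, <- comp_assoc, u1, comp_assoc, <- tensm_comp.
Qed.

Lemma multiplicative_id (A : C) (m : hom (A ⊗ A) A) :
  is_multiplicative m m (idm A).
Proof. unfold is_multiplicative; now rewrite tensm_id, comp_idl, comp_idr. Qed.

Lemma multiplicative_comp (A B D : C) (a : hom (A ⊗ A) A) (b : hom (B ⊗ B) B)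
    (d : hom (D ⊗ D) D) (v : hom B D) (u : hom A B) :
  is_multiplicative b d v -> is_multiplicative a b u ->
  is_multiplicative a d (v ∘ u).
Proof.
unfold is_multiplicative; intros hv hu.
now rewrite <- comp_assoc, hu, comp_assoc, hv, <- comp_assoc, <- tensm_comp.
Qed.

Lemma nonunital_bimonoid_morphism_id (B : nonunital_bimonoid) :
  is_nonunital_bimonoid_morphism (idm (nb_obj B)).
Proof. split; [apply multiplicative_id|apply comonoid_morphism_id]. Qed.

Lemma nonunital_bimonoid_morphism_comp (B1 B2 B3 : nonunital_bimonoid)
    (v : hom B2 B3) (u : hom B1 B2) :
  is_nonunital_bimonoid_morphism v -> is_nonunital_bimonoid_morphism u ->
  is_nonunital_bimonoid_morphism (v ∘ u).
Proof.
intros [v0 v1] [u0 u1]; split.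
- exact (multiplicative_comp v0 u0).
- exact (comonoid_morphism_comp v1 u1).
Qed.

Lemma hopf_morphism_id (H : hopf_monoid) : is_hopf_morphism (idm (hm_obj H)).
Proof.
split; [|apply comonoid_morphism_id].
split; [apply comp_idl|apply multiplicative_id].
Qed.

Lemma hopf_morphism_comp (H1 H2 H3 : hopf_monoid) (v : hom H2 H3)
    (u : hom H1 H2) :
  is_hopf_morphism v -> is_hopf_morphism u -> is_hopf_morphism (v ∘ u).
Proof.
intros [[v0 v1] v2] [[u0 u1] u2]; split; [split|].
- now rewrite <- comp_assoc, u0, v0.
- exact (multiplicative_comp v1 u1).
- exact (comonoid_morphism_comp v2 u2).
Qed.

Lemma hopf_truss_morphism_id (T : hopf_truss) :
  is_hopf_truss_morphism (idm (ht_obj T)).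
Proof.
split; [exact (hopf_morphism_id (ht_H1 T))|].
exact (nonunital_bimonoid_morphism_id (ht_H2 T)).
Qed.

Lemma hopf_truss_morphism_comp (T1 T2 T3 : hopf_truss) (v : hom T2 T3)
    (u : hom T1 T2) :
  is_hopf_truss_morphism v -> is_hopf_truss_morphism u ->
  is_hopf_truss_morphism (v ∘ u).
Proof.
intros [v0 v1] [u0 u1]; split.
- exact (hopf_morphism_comp v0 u0).
- exact (nonunital_bimonoid_morphism_comp v1 u1).
Qed.

Lemma gic_morphism_id (p : gen_inv_cocycle) :
  @is_gic_morphism p p (idm (nb_obj (gic_B p)), idm (hm_obj (gic_H p))).
Proof.
split; [apply nonunital_bimonoid_morphism_id|].
split; [apply hopf_morphism_id|].
now rewrite tensm_id, !comp_idl, !comp_idr.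
Qed.

Lemma gic_morphism_comp (p1 p2 p3 : gen_inv_cocycle)
    (v : hom (gic_B p2) (gic_B p3) * hom (gic_H p2) (gic_H p3))
    (u : hom (gic_B p1) (gic_B p2) * hom (gic_H p1) (gic_H p2)) :
  is_gic_morphism v -> is_gic_morphism u ->
  @is_gic_morphism p1 p3 (fst v ∘ fst u, snd v ∘ snd u).
Proof.
destruct v as [f' g'], u as [f g]; simpl.
intros (b' & h' & t' & q' & a') (b & h & t & q & a).
split; [exact (nonunital_bimonoid_morphism_comp b' b)|].
split; [exact (hopf_morphism_comp h' h)|].
repeat split.
- now rewrite <- comp_assoc, t, comp_assoc, t', comp_assoc.
- now rewrite <- comp_assoc, q, comp_assoc, q', comp_assoc.
- now rewrite <- comp_assoc, a, comp_assoc, a', <- comp_assoc, <- tensm_comp.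
Qed.

Definition HTr_hom (T T' : hopf_truss) : Type :=
  {f : hom T T' | is_hopf_truss_morphism f}.

Definition HTr_id (T : hopf_truss) : HTr_hom T T :=
  exist _ _ (hopf_truss_morphism_id T).

Definition HTr_comp (T1 T2 T3 : hopf_truss) (v : HTr_hom T2 T3)
    (u : HTr_hom T1 T2) : HTr_hom T1 T3 :=
  exist _ _ (hopf_truss_morphism_comp (proj2_sig v) (proj2_sig u)).

Lemma HTr_hom_eq (T T' : hopf_truss) (u v : HTr_hom T T') :
  proj1_sig u = proj1_sig v -> u = v.
Proof. apply eq_sig_hprop; intros; apply proof_irrelevance. Qed.

Definition HTr : category.
Proof.
refine (@Category hopf_truss HTr_hom HTr_id HTr_comp _ _ _);
  intros; apply HTr_hom_eq; simpl.
- apply comp_idl.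
- apply comp_idr.
- apply comp_assoc.
Defined.

Definition GIC_hom (p p' : gen_inv_cocycle) : Type :=
  {fg : hom (gic_B p) (gic_B p') * hom (gic_H p) (gic_H p') | is_gic_morphism fg}.

Definition GIC_id (p : gen_inv_cocycle) : GIC_hom p p :=
  exist _ _ (gic_morphism_id p).

Definition GIC_comp (p1 p2 p3 : gen_inv_cocycle) (v : GIC_hom p2 p3)
    (u : GIC_hom p1 p2) : GIC_hom p1 p3 :=
  exist _ _ (gic_morphism_comp (proj2_sig v) (proj2_sig u)).

Lemma GIC_hom_eq (p p' : gen_inv_cocycle) (u v : GIC_hom p p') :
  fst (proj1_sig u) = fst (proj1_sig v) ->
  snd (proj1_sig u) = snd (proj1_sig v) -> u = v.
Proof.
intros e1 e2; apply eq_sig_hprop; [intros; apply proof_irrelevance|].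
now rewrite (surjective_pairing (proj1_sig u)), e1, e2, <- surjective_pairing.
Qed.

Definition GIC : category.
Proof.
refine (@Category gen_inv_cocycle GIC_hom GIC_id GIC_comp _ _ _);
  intros; apply GIC_hom_eq; simpl.
- apply comp_idl.
- apply comp_idl.
- apply comp_idr.
- apply comp_idr.
- apply comp_assoc.
- apply comp_assoc.
Defined.

End BraidedAlgebra.

(* Main.v *)
(** A truss [T] gives the cocycle [id : H2 -> H1] with [θ = σ] and action [Γ];
    a cocycle [π : B -> H] gives a truss on [H] by transporting the product of
    [B] along [π], with [σ = π θ π^-1], and the action is then recovered as [Γ].

    In the convolution algebra of maps from [H] to [H1], [Γ] is the product of
    [S σ] and the second multiplication, and evaluating the compatibility
    condition at the unit forces [σ x = x ∘ 1].  Hence morphisms of trusses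
    preserve [σ] and [Γ].  In element notation,
    [Γ_x (Γ_y z) = Γ_{x1} (S σ y1) (S σ x2) ((x3 ∘ y2) ∘ z)], and the
    first two factors form the convolution inverse of [σ (x ∘ y)] on [H ⊗ H];
    thus [Γ_x Γ_y = Γ_{x ∘ y}]. *)

From Stdlib Require Import ProofIrrelevance IndefiniteDescription.
Require Import Defs.

Set Implicit Arguments.
Unset Strict Implicit.
Unset Printing Implicit Defensive.
Local Open Scope cat_scope.

(** * Equality of morphisms up to the strict identifications of objects *)

Section Strictness.
Variable C : strict_monoidal_category.
Implicit Types X Y Z W V : C.

(** Associativity and unitality of objects are only propositional, so two sides of a strict formula
    may live in different hom types. This relation compares them after transport; as equality proofs
    are unique, the equations used for the transport do not matter. *)
Definition heq X Y X' Y' (f : hom X Y) (g : hom X' Y') : Prop :=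
  exists (eX : X = X') (eY : Y = Y'), eqm eY ∘ f = g ∘ eqm eX.

Lemma heq_eq X Y (f g : hom X Y) : heq f g -> f = g.
Proof.
intros (eX & eY & e).
rewrite (proof_irrelevance _ eX eq_refl), (proof_irrelevance _ eY eq_refl) in e.
simpl in e; now rewrite comp_idl, comp_idr in e.
Qed.

Lemma heq_refl X Y (f : hom X Y) : heq f f.
Proof. exists eq_refl, eq_refl; simpl; now rewrite comp_idl, comp_idr. Qed.

Lemma heq_sym X Y X' Y' (f : hom X Y) (g : hom X' Y') : heq f g -> heq g f.
Proof.
intros (eX & eY & e); destruct eX, eY; simpl in e.
rewrite comp_idl, comp_idr in e; subst; apply heq_refl.
Qed.

Lemma heq_trans X Y X' Y' X'' Y'' (f : hom X Y) (g : hom X' Y')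
    (h : hom X'' Y'') : heq f g -> heq g h -> heq f h.
Proof.
intros (eX & eY & e); destruct eX, eY; simpl in e.
rewrite comp_idl, comp_idr in e; now subst.
Qed.

Lemma heq_comp X Y Z X' Y' Z' (g : hom Y Z) (f : hom X Y)
    (g' : hom Y' Z') (f' : hom X' Y') :
  heq g g' -> heq f f' -> heq (g ∘ f) (g' ∘ f').
Proof.
intros (eY & eZ & e) (eX & eY' & e'); destruct eX, eY', eZ.
rewrite (proof_irrelevance _ eY eq_refl) in e; simpl in *.
rewrite comp_idl, comp_idr in e, e'; subst; apply heq_refl.
Qed.

Lemma heq_tens X Y X' Y' Z W Z' W' (f : hom X Y) (f' : hom X' Y')
    (g : hom Z W) (g' : hom Z' W') :
  heq f f' -> heq g g' -> heq (f ⊗m g) (f' ⊗m g').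
Proof.
intros (eX & eY & e) (eZ & eW & e'); destruct eX, eY, eZ, eW; simpl in *.
rewrite comp_idl, comp_idr in e, e'; subst; apply heq_refl.
Qed.

Lemma heq_eqm_comp X Y Z X' Y' (e : Y = Z) (f : hom X Y) (g : hom X' Y') :
  heq f g -> heq (eqm e ∘ f) g.
Proof. destruct e; simpl; now rewrite comp_idl. Qed.

Lemma heq_comp_eqm X Y Z X' Y' (e : X = Y) (f : hom Y Z) (g : hom X' Y') :
  heq f g -> heq (f ∘ eqm e) g.
Proof. destruct e; simpl; now rewrite comp_idr. Qed.

Lemma heq_eqm X Y X' Y' (e : X = Y) (e' : X' = Y') : X = X' ->
  heq (eqm e) (eqm e').
Proof. intros eX; destruct e, e', eX; apply heq_refl. Qed.

Lemma heq_tensA X Y X' Y' X'' Y'' (f : hom X Y) (g : hom X' Y')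
    (h : hom X'' Y'') : heq ((f ⊗m g) ⊗m h) (f ⊗m (g ⊗m h)).
Proof. exists (tensA _ _ _), (tensA _ _ _); apply tensmA. Qed.

Lemma heq_tens1l X Y (f : hom X Y) : heq (idm unit_obj ⊗m f) f.
Proof. exists (tens1l _), (tens1l _); apply tensm1l. Qed.

Lemma heq_tens1r X Y (f : hom X Y) : heq (f ⊗m idm unit_obj) f.
Proof. exists (tens1r _), (tens1r _); apply tensm1r. Qed.

(** Tensoring transports gives a transport again, so after expansion each one stands as a separate
    factor that [heq_eqm_comp] or [heq_comp_eqm] discards. *)
Lemma eqm_tens X Y Z W (e : X = Y) (e' : Z = W) :
  eqm e ⊗m eqm e' = eqm (f_equal2 tens e e').
Proof. destruct e, e'; rewrite (proof_irrelevance _ (f_equal2 _ _ _) eq_refl); exact (tensm_id _ _). Qed.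

Lemma eqm_tensr X Z W (e' : Z = W) :
  idm X ⊗m eqm e' = eqm (f_equal2 tens eq_refl e').
Proof. destruct e'; rewrite (proof_irrelevance _ (f_equal2 _ _ _) eq_refl); exact (tensm_id _ _). Qed.

Lemma eqm_tensl X Z W (e' : Z = W) :
  eqm e' ⊗m idm X = eqm (f_equal2 tens e' eq_refl).
Proof. destruct e'; rewrite (proof_irrelevance _ (f_equal2 _ _ _) eq_refl); exact (tensm_id _ _). Qed.

Lemma tensm_compl X Y Z W (g : hom Y Z) (f : hom X Y) :
  (g ∘ f) ⊗m idm W = (g ⊗m idm W) ∘ (f ⊗m idm W).
Proof. now rewrite <- tensm_comp, comp_idl. Qed.

Lemma tensm_compr X Y Z W (g : hom Y Z) (f : hom X Y) :
  idm W ⊗m (g ∘ f) = (idm W ⊗m g) ∘ (idm W ⊗m f).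
Proof. now rewrite <- tensm_comp, comp_idl. Qed.

Lemma tensm_split X Y Z W (f : hom X Y) (g : hom Z W) :
  f ⊗m g = (f ⊗m idm W) ∘ (idm X ⊗m g).
Proof. now rewrite <- tensm_comp, comp_idl, comp_idr. Qed.

Lemma tensm_slide X Y Z W (f : hom X Y) (g : hom Z W) :
  (f ⊗m idm W) ∘ (idm X ⊗m g) = (idm Y ⊗m g) ∘ (f ⊗m idm Z).
Proof. now rewrite <- !tensm_comp, !comp_idl, !comp_idr. Qed.

(** By strictness, tensoring with the unit object changes a morphism only by transport. Laws proved
    with a free right-hand object [Z] descend to the bare maps in this way. *)
Lemma tensm_faithful X Y (f g : hom X Y) :
  f ⊗m idm unit_obj = g ⊗m idm unit_obj -> f = g.
Proof.
intros e; apply heq_eq, heq_trans with (2 := heq_tens1r g).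
rewrite <- e; apply heq_sym, heq_tens1r.
Qed.

(** Tensoring a structure map with an arbitrary [Z] on the right and
    reassociating makes every object a right-nested tensor word, so that
    composites of these maps and of left whiskerings need no [eqm]; the
    interchange law becomes naturality in [Z].  Taking [Z] to be the unit
    object recovers the original map. *)

Definition lw X Y Z (f : hom Y Z) : hom (X ⊗ Y) (X ⊗ Z) := idm X ⊗m f.
Definition rw X Y (f : hom X Y) Z : hom (X ⊗ Z) (Y ⊗ Z) := f ⊗m idm Z.
Definition op2 X Y W (m : hom (X ⊗ Y) W) Z : hom (X ⊗ (Y ⊗ Z)) (W ⊗ Z) :=
  (m ⊗m idm Z) ∘ assoc_inv X Y Z.
Definition cop X Y W (d : hom W (X ⊗ Y)) Z : hom (W ⊗ Z) (X ⊗ (Y ⊗ Z)) :=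
  assoc X Y Z ∘ (d ⊗m idm Z).
Definition un X (u : hom unit_obj X) Z : hom Z (X ⊗ Z) :=
  (u ⊗m idm Z) ∘ unitl_inv Z.
Definition cu X (e : hom X unit_obj) Z : hom (X ⊗ Z) Z :=
  unitl Z ∘ (e ⊗m idm Z).

End Strictness.

Arguments lw {C} X {Y Z} f.
Notation "X ◁ f" := (lw X f) (at level 38, right associativity) : cat_scope.
Notation "f ▷ Z" := (rw f Z) (at level 37, left associativity) : cat_scope.


(** * Comparison of composites modulo strictness *)

Lemma heq_idm (C : strict_monoidal_category) (X Y : C) :
  X = Y -> heq (idm X) (idm Y).
Proof. intros []; apply heq_refl. Qed.

Lemma heq_tensA_idm (C : strict_monoidal_category) (X Y Z W : C) (f : hom Z W) :
  heq (idm (X ⊗ Y) ⊗m f) (idm X ⊗m (idm Y ⊗m f)).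
Proof. rewrite <- tensm_id; apply heq_tensA. Qed.

Ltac unfold_whisker :=
  unfold lw, rw, op2, cop, un, cu, assoc, assoc_inv,
    unitl, unitr, unitl_inv, mid_braid.

Ltac split_tensors :=
  repeat match goal with
  | |- context [?f ⊗m ?g] =>
      lazymatch f with idm _ => fail | eqm _ => fail | _ =>
      lazymatch g with idm _ => fail | _ => rewrite (tensm_split f g) end end
  end.

(** Normal form: a right-nested composite of layers, each a transport or a single generator tensored
    with identities. *)
Ltac norm_whisker :=
  unfold_whisker; split_tensors;
  repeat first [ rewrite tensm_compl | rewrite tensm_compr ];
  repeat first [ rewrite eqm_tensr | rewrite eqm_tensl | rewrite eqm_tens ];
  rewrite ?tensm_id, ?comp_idl, ?comp_idr, <- ?comp_assoc.

Ltac heq_obj := rewrite ?tensA, ?tens1l, ?tens1r; reflexivity.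

Ltac heq_layer :=
  lazymatch goal with
  | |- heq (idm _) (idm _) => apply heq_idm; heq_obj
  | |- heq ((_ ⊗m _) ⊗m _) _ =>
      refine (heq_trans (heq_tensA _ _ _) _); heq_layer
  | |- heq (idm (_ ⊗ _) ⊗m _) _ =>
      refine (heq_trans (heq_tensA_idm _ _ _) _); heq_layer
  | |- heq (idm unit_obj ⊗m _) _ =>
      refine (heq_trans (heq_tens1l _) _); heq_layer
  | |- heq _ ((_ ⊗m _) ⊗m _) => apply heq_sym; heq_layer
  | |- heq _ (idm (_ ⊗ _) ⊗m _) => apply heq_sym; heq_layer
  | |- heq _ (idm unit_obj ⊗m _) => apply heq_sym; heq_layer
  | |- heq (_ ⊗m _) (_ ⊗m _) => apply heq_tens; rewrite ?tensm_id; heq_layer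
  | |- _ => apply heq_refl
  end.

(** Decides equality of two composites of whiskered generators, up to the
    strict identifications but without interchange. *)
Ltac heq_layers :=
  lazymatch goal with
  | |- heq (eqm _ ∘ _) _ => apply heq_eqm_comp; heq_layers
  | |- heq (_ ∘ eqm _) _ => apply heq_comp_eqm; heq_layers
  | |- heq _ (eqm _ ∘ _) => apply heq_sym; heq_layers
  | |- heq _ (_ ∘ eqm _) => apply heq_sym; heq_layers
  | |- heq (eqm _) (eqm _) => apply heq_eqm; heq_obj
  | |- heq (eqm _) (idm _) => apply (heq_eqm _ (eq_refl _)); heq_obj
  | |- heq (idm _) (eqm _) => apply (heq_eqm (eq_refl _)); heq_obj
  | |- heq (_ ∘ _) (_ ∘ _) => apply heq_comp; [heq_layer | heq_layers]
  | |- _ => heq_layer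
  end.

(* The middle term may have another source and target than the two sides of the goal: it is
   bracketed so that a hypothesis applies to it literally, and [strict] settles the passage on
   either side. *)
Tactic Notation "via" constr(f) :=
  apply heq_eq, (fun a => heq_trans (g := f) a).

Ltac strict := norm_whisker; heq_layers.

(** * Naturality of whiskered structure maps *)

Section Calculus.
Variable C : strict_monoidal_category.
Implicit Types X Y Z W V : C.

Lemma lw_comp X Y Z W (g : hom Z W) (f : hom Y Z) :
  X ◁ (g ∘ f) = (X ◁ g) ∘ (X ◁ f).
Proof. apply tensm_compr. Qed.

Lemma lw_id X Y : X ◁ idm Y = idm (X ⊗ Y).
Proof. apply tensm_id. Qed.

Lemma rw_comp X Y Z W (g : hom Z W) (f : hom Y Z) :
  (g ∘ f) ▷ X = (g ▷ X) ∘ (f ▷ X).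
Proof. apply tensm_compl. Qed.

Lemma rw_id X Y : idm X ▷ Y = idm (X ⊗ Y).
Proof. apply tensm_id. Qed.

Lemma rw_faithful X Y (f g : hom X Y) :
  f ▷ unit_obj = g ▷ unit_obj -> f = g.
Proof. apply tensm_faithful. Qed.

Lemma rw_nat X Y Z W (f : hom X Y) (g : hom Z W) :
  (f ▷ W) ∘ (X ◁ g) = (Y ◁ g) ∘ (f ▷ Z).
Proof. apply tensm_slide. Qed.

Lemma op2_nat X Y W (m : hom (X ⊗ Y) W) Z V (f : hom Z V) :
  op2 m V ∘ (X ◁ Y ◁ f) = (W ◁ f) ∘ op2 m Z.
Proof.
via ((m ▷ V) ∘ ((X ⊗ Y) ◁ f)).
strict. rewrite rw_nat. strict.
Qed.

Lemma cop_nat X Y W (d : hom W (X ⊗ Y)) Z V (f : hom Z V) :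
  cop d V ∘ (W ◁ f) = (X ◁ Y ◁ f) ∘ cop d Z.
Proof.
via ((d ▷ V) ∘ (W ◁ f)).
strict. rewrite rw_nat. strict.
Qed.

Lemma un_nat X (u : hom unit_obj X) Z V (f : hom Z V) :
  un u V ∘ f = (X ◁ f) ∘ un u Z.
Proof.
via ((u ▷ V) ∘ (unit_obj ◁ f)).
strict. rewrite rw_nat. strict.
Qed.

Lemma cu_nat X (e : hom X unit_obj) Z V (f : hom Z V) :
  cu e V ∘ (X ◁ f) = f ∘ cu e Z.
Proof.
via ((e ▷ V) ∘ (X ◁ f)).
strict. rewrite rw_nat. strict.
Qed.

End Calculus.

(** * Coherence of the braiding with units, coproducts and counits *)

Lemma iso_idempotent (C : category) (X : C) (f : hom X X) : is_iso f -> f ∘ f = f -> f = idm X.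
Proof.
intros (g & e & _) h.
transitivity (g ∘ f ∘ f).
- now rewrite e, comp_idl.
- now rewrite <- comp_assoc, h.
Qed.

Lemma eqm_iso (C : category) (X Y : C) (e : X = Y) : is_iso (eqm e).
Proof. destruct e; exists (idm X); split; apply comp_idl. Qed.

Lemma iso_comp (C : category) (X Y Z : C) (g : hom Y Z) (f : hom X Y) :
  is_iso g -> is_iso f -> is_iso (g ∘ f).
Proof.
intros (g' & e1 & e2) (f' & e3 & e4); exists (f' ∘ g'); split.
- now rewrite comp_assoc, <- (comp_assoc f' g' g), e1, comp_idr.
- now rewrite comp_assoc, <- (comp_assoc g f f'), e4, comp_idr.
Qed.

Section Braid.
Variable C : strict_braided_monoidal_category.
Implicit Types X Y Z W V : C.

(** This is [c ⊗ Z] on right-nested words. *)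
Definition br X Y Z : hom (X ⊗ (Y ⊗ Z)) (Y ⊗ (X ⊗ Z)) :=
  assoc Y X Z ∘ (braid X Y ▷ Z) ∘ assoc_inv X Y Z.

Lemma braid_tensr_eq X Y Z :
  braid X (Y ⊗ Z)
  = assoc_inv Y Z X ∘ (Y ◁ braid X Z) ∘ assoc Y X Z ∘ (braid X Y ▷ Z)
      ∘ assoc_inv X Y Z.
Proof.
via (assoc Y Z X ∘ braid X (Y ⊗ Z) ∘ assoc X Y Z).
strict. rewrite braid_tensr. strict.
Qed.

Lemma braid_tensl_eq X Y Z :
  braid (X ⊗ Y) Z
  = assoc Z X Y ∘ (braid X Z ▷ Y) ∘ assoc_inv X Z Y ∘ (X ◁ braid Y Z)
      ∘ assoc X Y Z.
Proof.
via (assoc_inv Z X Y ∘ braid (X ⊗ Y) Z ∘ assoc_inv X Y Z).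
strict. rewrite braid_tensl. strict.
Qed.

Lemma heq_braid X Y X' Y' :
  X = X' -> Y = Y' -> heq (braid X Y) (braid X' Y').
Proof. intros [] []; apply heq_refl. Qed.

(** Triviality of the braiding with the unit object is a consequence of the hexagon: transported to
    an endomorphism of [Z], this braiding is idempotent and invertible. *)
Lemma heq_braid_unitl Z : heq (braid unit_obj Z) (idm (unit_obj ⊗ Z)).
Proof.
pose (b := unitr Z ∘ braid unit_obj Z ∘ unitl_inv Z).
assert (hb : heq (braid unit_obj Z) b) by (unfold b; strict).
refine (heq_trans hb _).
rewrite (@iso_idempotent C Z b); [apply heq_idm; heq_obj | |].
- repeat apply iso_comp; first [apply eqm_iso | apply braid_iso].
- apply heq_eq.
  (* The braiding of [unit_obj ⊗ unit_obj] with [Z] is [b] twice by the hexagon, and [b] once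
     because [unit_obj ⊗ unit_obj] is [unit_obj]. *)
  refine (heq_trans (g := braid (unit_obj ⊗ unit_obj) Z) _ _).
  + rewrite braid_tensl_eq.
    refine (heq_trans
      (g := (braid unit_obj Z ▷ unit_obj) ∘ (assoc_inv unit_obj Z unit_obj
         ∘ (unit_obj ◁ braid unit_obj Z))) _ _); [|strict].
    apply heq_comp.
    * apply heq_sym, (heq_trans (heq_tens1r _)), hb.
    * apply heq_sym, heq_eqm_comp, (heq_trans (heq_tens1l _)), hb.
  + refine (heq_trans (heq_braid (tens1l _) eq_refl) hb).
Qed.

Lemma heq_braid_unitr Z : heq (braid Z unit_obj) (idm (Z ⊗ unit_obj)).
Proof.
pose (b := unitl Z ∘ braid Z unit_obj ∘ eqm (eq_sym (tens1r Z))).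
assert (hb : heq (braid Z unit_obj) b) by (unfold b; strict).
refine (heq_trans hb _).
rewrite (@iso_idempotent C Z b); [apply heq_idm; heq_obj | |].
- repeat apply iso_comp; first [apply eqm_iso | apply braid_iso].
- apply heq_eq.
  refine (heq_trans (g := braid Z (unit_obj ⊗ unit_obj)) _ _).
  + rewrite braid_tensr_eq.
    refine (heq_trans
      (g := (unit_obj ◁ braid Z unit_obj) ∘ (assoc unit_obj Z unit_obj
         ∘ (braid Z unit_obj ▷ unit_obj))) _ _); [|strict].
    apply heq_comp.
    * apply heq_sym, (heq_trans (heq_tens1l _)), hb.
    * apply heq_sym, heq_eqm_comp, (heq_trans (heq_tens1r _)), hb.
  + refine (heq_trans (heq_braid eq_refl (tens1l _)) hb).
Qed.

Lemma br_nat X Y Z W (f : hom Z W) :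
  br X Y W ∘ (X ◁ Y ◁ f) = (Y ◁ X ◁ f) ∘ br X Y Z.
Proof.
unfold br; via ((braid X Y ▷ W) ∘ ((X ⊗ Y) ◁ f)).
strict. rewrite rw_nat. strict.
Qed.

Lemma br_natr X Y Y' Z (f : hom Y Y') :
  br X Y' Z ∘ (X ◁ (f ▷ Z)) = (f ▷ (X ⊗ Z)) ∘ br X Y Z.
Proof.
unfold br; via ((braid X Y' ∘ (idm X ⊗m f)) ▷ Z).
strict. rewrite braid_natural. strict.
Qed.

(** Naturality moves [d] to the other side of the braiding, and the hexagon then splits the braiding
    with [X ⊗ Y]. *)
Lemma cop_br V X Y W (d : hom W (X ⊗ Y)) Z :
  cop d (V ⊗ Z) ∘ br V W Z
  = (X ◁ br V Y Z) ∘ br V X (Y ⊗ Z) ∘ (V ◁ cop d Z).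
Proof.
unfold br; via (((d ⊗m idm V) ∘ braid V W) ▷ Z).
strict. rewrite <- braid_natural, braid_tensr_eq. strict.
Qed.

Lemma lw_cop_br V X Y W (d : hom W (X ⊗ Y)) Z :
  (V ◁ cop d Z) ∘ br W V Z
  = br X V (Y ⊗ Z) ∘ (X ◁ br Y V Z) ∘ cop d (V ⊗ Z).
Proof.
unfold br; via (((idm V ⊗m d) ∘ braid W V) ▷ Z).
strict. rewrite <- braid_natural, braid_tensl_eq. strict.
Qed.

(** Naturality turns the braiding into one with the unit object, which is an identity. *)
Lemma cu_br X Y (e : hom Y unit_obj) Z :
  cu e (X ⊗ Z) ∘ br X Y Z = X ◁ cu e Z.
Proof.
unfold br; via (((e ⊗m idm X) ∘ braid X Y) ▷ Z).
strict. rewrite <- braid_natural.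
refine (heq_trans (g := (braid X unit_obj ▷ Z) ∘ ((X ◁ e) ▷ Z)) _ _).
strict.
refine (heq_trans (g := idm ((X ⊗ unit_obj) ⊗ Z) ∘ ((X ◁ e) ▷ Z)) _ _).
apply heq_comp; [|apply heq_refl].
rewrite <- tensm_id; apply heq_tens; [apply heq_braid_unitr|apply heq_refl].
rewrite comp_idl; strict.
Qed.

Lemma lw_cu_br X Y (e : hom X unit_obj) Z :
  (Y ◁ cu e Z) ∘ br X Y Z = cu e (Y ⊗ Z).
Proof.
unfold br; via (((idm Y ⊗m e) ∘ braid X Y) ▷ Z).
strict. rewrite <- braid_natural.
refine (heq_trans (g := (braid unit_obj Y ▷ Z) ∘ ((e ▷ Y) ▷ Z)) _ _).
strict.
refine (heq_trans (g := idm ((unit_obj ⊗ Y) ⊗ Z) ∘ ((e ▷ Y) ▷ Z)) _ _).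
apply heq_comp; [|apply heq_refl].
rewrite <- tensm_id; apply heq_tens; [apply heq_braid_unitl|apply heq_refl].
rewrite comp_idl; strict.
Qed.

Lemma br_un X Y (u : hom unit_obj Y) Z :
  br X Y Z ∘ (X ◁ un u Z) = un u (X ⊗ Z).
Proof.
unfold br; via ((braid X Y ∘ (idm X ⊗m u)) ▷ Z).
strict. rewrite braid_natural.
refine (heq_trans (g := ((u ▷ X) ▷ Z) ∘ (braid X unit_obj ▷ Z)) _ _).
strict.
refine (heq_trans (g := ((u ▷ X) ▷ Z) ∘ idm ((unit_obj ⊗ X) ⊗ Z)) _ _).
apply heq_comp; [apply heq_refl|].
rewrite <- tensm_id; apply heq_tens; [|apply heq_refl].
refine (heq_trans (heq_braid_unitr X) _); apply heq_idm; heq_obj.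
rewrite comp_idr; strict.
Qed.

End Braid.

(** * Rewriting inside whiskered composites *)

Lemma reassoc (C : category) (X Y Z W : C) (g : hom Y Z) (f : hom X Y)
    (h : hom X Z) (k : hom W X) : g ∘ f = h -> g ∘ (f ∘ k) = h ∘ k.
Proof. intros <-; apply comp_assoc. Qed.

Lemma whole (C : category) (X Y Z : C) (g : hom Y Z) (f : hom X Y)
    (h : hom X Z) : g ∘ f = h -> g ∘ f = h.
Proof. exact (fun e => e). Qed.

Lemma whisk (C : strict_monoidal_category) (V X Y Z : C) (g : hom Y Z)
    (f : hom X Y) (h : hom X Z) : g ∘ f = h -> (V ◁ g) ∘ (V ◁ f) = V ◁ h.
Proof. intros <-; symmetry; apply lw_comp. Qed.

Ltac nf := rewrite ?lw_comp, ?rw_comp, ?lw_id, ?rw_id, <- ?comp_assoc,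
  ?comp_idl, ?comp_idr.

(** Rewrites with an equation between composites inside a longer right-nested
    composite, possibly under one or two left whiskerings. *)
Tactic Notation "slide" uconstr(H) :=
  first [ rewrite (reassoc _ H) | rewrite (whole H)
        | rewrite (reassoc _ (whisk _ H)) | rewrite (whisk _ H)
        | rewrite (reassoc _ (whisk _ (whisk _ H))) | rewrite (whisk _ (whisk _ H)) ];
  nf.

(** * Whiskered monoid and comonoid laws, and convolution *)

Section Algebra.
Variable C : strict_braided_monoidal_category.
Implicit Types X Y Z W A D E : C.

Lemma op2_assoc A (m : hom (A ⊗ A) A) Z : associative_product m ->
  op2 m Z ∘ (A ◁ op2 m Z) = op2 m Z ∘ op2 m (A ⊗ Z).
Proof.
unfold associative_product; intros h.
via ((m ∘ (idm A ⊗m m) ∘ assoc A A A) ▷ Z).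
strict. rewrite h. strict.
Qed.

Lemma op2_unl A (a : monoid_ops A) Z : is_monoid a ->
  op2 (mon_mul a) Z ∘ un (mon_unit a) (A ⊗ Z) = idm (A ⊗ Z).
Proof.
intros (_ & h & _); via ((mon_mul a ∘ (mon_unit a ⊗m idm A)) ▷ Z).
strict. rewrite h. strict.
Qed.

Lemma op2_unr A (a : monoid_ops A) Z : is_monoid a ->
  op2 (mon_mul a) Z ∘ (A ◁ un (mon_unit a) Z) = idm (A ⊗ Z).
Proof.
intros (_ & _ & h); via ((mon_mul a ∘ (idm A ⊗m mon_unit a)) ▷ Z).
strict. rewrite h. strict.
Qed.

Lemma coassoc D (d : comonoid_ops D) Z : is_comonoid d ->
  cop (coprod d) (D ⊗ Z) ∘ cop (coprod d) Z
  = (D ◁ cop (coprod d) Z) ∘ cop (coprod d) Z.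
Proof.
intros (h & _ & _).
via ((assoc D D D ∘ (coprod d ⊗m idm D) ∘ coprod d) ▷ Z).
strict. rewrite h. strict.
Qed.

Lemma cul_cop D (d : comonoid_ops D) Z : is_comonoid d ->
  cu (counit d) (D ⊗ Z) ∘ cop (coprod d) Z = idm (D ⊗ Z).
Proof.
intros (_ & h & _).
via ((unitl D ∘ (counit d ⊗m idm D) ∘ coprod d) ▷ Z).
strict. rewrite h. strict.
Qed.

Lemma cur_cop D (d : comonoid_ops D) Z : is_comonoid d ->
  (D ◁ cu (counit d) Z) ∘ cop (coprod d) Z = idm (D ⊗ Z).
Proof.
intros (_ & _ & h).
via ((unitr D ∘ (idm D ⊗m counit d) ∘ coprod d) ▷ Z).
strict. rewrite h. strict.
Qed.

Lemma cop_morphism D E (d : comonoid_ops D) (e : comonoid_ops E) (f : hom D E)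
    Z : is_comonoid_morphism d e f ->
  cop (coprod e) Z ∘ (f ▷ Z)
  = (f ▷ (E ⊗ Z)) ∘ (D ◁ (f ▷ Z)) ∘ cop (coprod d) Z.
Proof.
intros (_ & h); via ((coprod e ∘ f) ▷ Z).
strict. rewrite h. strict.
Qed.

Lemma op2_multiplicative A B (a : hom (A ⊗ A) A) (b : hom (B ⊗ B) B)
    (f : hom A B) Z : is_multiplicative a b f ->
  (f ▷ Z) ∘ op2 a Z = op2 b Z ∘ (f ▷ (B ⊗ Z)) ∘ (A ◁ (f ▷ Z)).
Proof.
unfold is_multiplicative; intros h; via ((f ∘ a) ▷ Z).
strict. rewrite h. strict.
Qed.

Definition conv D A (d : comonoid_ops D) (a : monoid_ops A) (f g : hom D A) :
  hom D A := mon_mul a ∘ (f ⊗m g) ∘ coprod d.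

Definition conv1 D A (d : comonoid_ops D) (a : monoid_ops A) : hom D A :=
  mon_unit a ∘ counit d.

(** Left convolution by [f] with parameters: [x ⊗ z] goes to [f(x1) · h(x2 ⊗ z)], the product being
    taken in the first tensor factor. By [rw_conv] it extends [conv]. *)
Definition act D A (d : comonoid_ops D) (a : monoid_ops A) (f : hom D A) Z W
    (h : hom (D ⊗ Z) (A ⊗ W)) : hom (D ⊗ Z) (A ⊗ W) :=
  op2 (mon_mul a) W ∘ (f ▷ (A ⊗ W)) ∘ (D ◁ h) ∘ cop (coprod d) Z.

Section Convolution.
Variables (D A : C) (d : comonoid_ops D) (a : monoid_ops A).
Hypotheses (hd : is_comonoid d) (ha : is_monoid a).

Lemma rw_conv (f g : hom D A) Z : conv d a f g ▷ Z = act d a f (g ▷ Z).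
Proof. unfold conv, act; apply heq_eq; strict. Qed.

Lemma rw_conv1 Z : conv1 d a ▷ Z = un (mon_unit a) Z ∘ cu (counit d) Z.
Proof. unfold conv1; apply heq_eq; strict. Qed.

(** Coassociativity of [d] and associativity of [a] make [act] an action of the convolution algebra;
    associativity of [conv] is the case of an [h] of the form [k ▷ Z]. *)
Lemma act_conv (f g : hom D A) Z W (h : hom (D ⊗ Z) (A ⊗ W)) :
  act d a (conv d a f g) h = act d a f (act d a g h).
Proof.
unfold act; rewrite rw_conv; unfold act; nf.
slide (cop_nat (coprod d) _).
slide (coassoc Z hd).
slide (rw_nat f (op2 _ _)).
slide (op2_assoc _ (proj1 ha)).
reflexivity.
Qed.

Lemma act_conv1 Z W (h : hom (D ⊗ Z) (A ⊗ W)) :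
  act d a (conv1 d a) h = h.
Proof.
unfold act; rewrite rw_conv1; nf.
slide (cu_nat (counit d) _).
slide (cul_cop Z hd).
slide (op2_unl W ha).
reflexivity.
Qed.

Lemma conv_assoc (f g h : hom D A) :
  conv d a (conv d a f g) h = conv d a f (conv d a g h).
Proof. apply rw_faithful; now rewrite !rw_conv, act_conv. Qed.

Lemma conv_1l (f : hom D A) : conv d a (conv1 d a) f = f.
Proof. apply rw_faithful; now rewrite rw_conv, act_conv1. Qed.

Lemma conv_1r (f : hom D A) : conv d a f (conv1 d a) = f.
Proof.
apply rw_faithful; rewrite rw_conv; unfold act; rewrite rw_conv1; nf.
slide (cur_cop _ hd). slide (rw_nat f _). slide (op2_unr _ ha). reflexivity.
Qed.

Lemma conv_inverse_unique (f g h : hom D A) :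
  conv d a f g = conv1 d a -> conv d a g h = conv1 d a -> f = h.
Proof.
intros e e'; now rewrite <- (conv_1r f), <- e', <- conv_assoc, e, conv_1l.
Qed.

End Convolution.

Lemma conv_precomp D E A (d : comonoid_ops D) (e : comonoid_ops E)
    (a : monoid_ops A) (k : hom D E) (f g : hom E A) :
  is_comonoid_morphism d e k ->
  conv e a f g ∘ k = conv d a (f ∘ k) (g ∘ k).
Proof.
intros [_ h]; unfold conv.
now rewrite <- comp_assoc, h, tensm_comp, !comp_assoc.
Qed.

Lemma conv1_precomp D E A (d : comonoid_ops D) (e : comonoid_ops E)
    (a : monoid_ops A) (k : hom D E) :
  is_comonoid_morphism d e k -> conv1 e a ∘ k = conv1 d a.
Proof. intros [h _]; unfold conv1; now rewrite <- comp_assoc, h. Qed.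

Lemma conv_postcomp D A B (d : comonoid_ops D) (a : monoid_ops A)
    (b : monoid_ops B) (k : hom A B) (f g : hom D A) :
  is_monoid_morphism a b k ->
  k ∘ conv d a f g = conv d b (k ∘ f) (k ∘ g).
Proof.
intros [_ h]; unfold conv; rewrite !comp_assoc, h.
now rewrite tensm_comp, !comp_assoc.
Qed.

Lemma conv1_postcomp D A B (d : comonoid_ops D) (a : monoid_ops A)
    (b : monoid_ops B) (k : hom A B) :
  is_monoid_morphism a b k -> k ∘ conv1 d a = conv1 d b.
Proof. intros [h _]; unfold conv1; now rewrite comp_assoc, h. Qed.

Section Action.
Variables (D A : C) (d : comonoid_ops D) (a : monoid_ops A).
Hypotheses (hd : is_comonoid d) (ha : is_monoid a).

Lemma act_lw (f : hom D A) X Z W (h : hom (D ⊗ Z) (A ⊗ W)) (k : hom X Z) :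
  act d a f (h ∘ (D ◁ k)) = act d a f h ∘ (D ◁ k).
Proof. unfold act; nf. slide (cop_nat (coprod d) _). reflexivity. Qed.

Lemma act_op2 (f : hom D A) Z W (h : hom (D ⊗ Z) (A ⊗ (A ⊗ W))) :
  act d a f (op2 (mon_mul a) W ∘ h) = op2 (mon_mul a) W ∘ act d a f h.
Proof.
unfold act; nf. slide (rw_nat f _). slide (op2_assoc _ (proj1 ha)). reflexivity.
Qed.

Lemma act_cop (f : hom D A) Z W (h : hom (D ⊗ (D ⊗ Z)) (A ⊗ W)) :
  act d a f (h ∘ cop (coprod d) Z) = act d a f h ∘ cop (coprod d) Z.
Proof. unfold act; nf. slide (coassoc Z hd). reflexivity. Qed.

Lemma act_precomp E (e : comonoid_ops E) (k : hom E D) (f : hom D A) Z W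
    (h : hom (D ⊗ Z) (A ⊗ W)) :
  is_comonoid_morphism e d k ->
  act d a f h ∘ (k ▷ Z) = act e a (f ∘ k) (h ∘ (k ▷ Z)).
Proof.
intros hk; unfold act; nf.
slide (cop_morphism Z hk). slide (rw_nat k h). reflexivity.
Qed.

End Action.
End Algebra.

(** * The tensor product of two comonoids *)

Section TensorComonoid.
Variable C : strict_braided_monoidal_category.
Variables (D E : C) (d : comonoid_ops D) (e : comonoid_ops E).
Hypotheses (hd : is_comonoid d) (he : is_comonoid e).
Implicit Types X Y Z W A : C.

Definition cop2 Z : hom (D ⊗ (E ⊗ Z)) (D ⊗ (E ⊗ (D ⊗ (E ⊗ Z)))) :=
  (D ◁ br D E (E ⊗ Z)) ∘ cop (coprod d) (E ⊗ (E ⊗ Z)) ∘ (D ◁ cop (coprod e) Z).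

Definition cu2 Z : hom (D ⊗ (E ⊗ Z)) Z := cu (counit d) Z ∘ (D ◁ cu (counit e) Z).

(** Both sides reduce to iterated coproducts of [D] and of [E] followed by braidings; the hexagons
    in [cop_br] and [lw_cop_br] let a coproduct pass a braiding. *)
Lemma cop2_coassoc Z : cop2 (D ⊗ (E ⊗ Z)) ∘ cop2 Z = (D ◁ E ◁ cop2 Z) ∘ cop2 Z.
Proof.
unfold cop2; nf.
slide (cop_br D (coprod e) (E ⊗ Z)).
slide (eq_sym (cop_nat (coprod d) (cop (coprod e) (E ⊗ Z)))).
slide (coassoc Z he).
slide (cop_nat (coprod d) (E ◁ br D E (E ⊗ Z))).
slide (cop_nat (coprod d) (br D E (E ⊗ (E ⊗ Z)))).
slide (coassoc (E ⊗ (E ⊗ (E ⊗ Z))) hd).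
slide (br_nat D E (br D E (E ⊗ Z))).
(* The other side is now brought to the same form, with every coproduct applied before the
   braidings. *)
symmetry.
slide (eq_sym (br_nat D E (cop (coprod e) Z))).
slide (eq_sym (cop_nat (coprod d) (E ◁ cop (coprod e) Z))).
slide (lw_cop_br E (coprod d) (E ⊗ (E ⊗ Z))).
reflexivity.
Qed.

Lemma cul_cop2 Z : cu2 (D ⊗ (E ⊗ Z)) ∘ cop2 Z = idm (D ⊗ (E ⊗ Z)).
Proof.
unfold cop2, cu2; nf.
slide (cu_br D (counit e) (E ⊗ Z)).
slide (eq_sym (cop_nat (coprod d) (cu (counit e) (E ⊗ Z)))).
slide (cul_cop Z he).
slide (cul_cop (E ⊗ Z) hd).
reflexivity.
Qed.

Lemma cur_cop2 Z : (D ◁ E ◁ cu2 Z) ∘ cop2 Z = idm (D ⊗ (E ⊗ Z)).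
Proof.
unfold cop2, cu2; nf.
slide (eq_sym (br_nat D E (cu (counit e) Z))).
slide (lw_cu_br E (counit d) Z).
slide (cu_nat (counit d) (E ◁ cu (counit e) Z)).
slide (cur_cop (E ⊗ (E ⊗ Z)) hd).
slide (cur_cop Z he).
reflexivity.
Qed.

(** This makes the maps from [D ⊗ E] to a monoid a convolution algebra, in which inverses are
    unique. *)
Lemma tens_comonoid_is_comonoid : is_comonoid (tens_comonoid d e).
Proof.
repeat split; apply rw_faithful; simpl.
- via (cop2 (D ⊗ (E ⊗ unit_obj)) ∘ cop2 unit_obj); [unfold cop2, br; strict|].
  rewrite cop2_coassoc; unfold cop2, br; strict.
- via (cu2 (D ⊗ (E ⊗ unit_obj)) ∘ cop2 unit_obj);
    [unfold cu2, cop2, br; strict|].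
  rewrite cul_cop2; strict.
- via ((D ◁ E ◁ cu2 unit_obj) ∘ cop2 unit_obj);
    [unfold cu2, cop2, br; strict|].
  rewrite cur_cop2; strict.
Qed.
End TensorComonoid.

(** * Convolution over a tensor product of comonoids *)

Section TensorAction.
Variable C : strict_braided_monoidal_category.
Variables (D E A : C) (d : comonoid_ops D) (e : comonoid_ops E)
  (a : monoid_ops A).
Hypotheses (hd : is_comonoid d) (he : is_comonoid e) (ha : is_monoid a).
Implicit Types X Y Z W : C.

(** The analogue of [act] for the comonoid [D ⊗ E], bracketed to the right; [act2_act] transfers the
    laws of [act] to it. *)
Definition act2 (f : hom (D ⊗ E) A) Z W (h : hom (D ⊗ (E ⊗ Z)) (A ⊗ W)) :
    hom (D ⊗ (E ⊗ Z)) (A ⊗ W) :=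
  op2 (mon_mul a) W ∘ op2 f (A ⊗ W) ∘ (D ◁ E ◁ h) ∘ cop2 d e Z.

Lemma act2_act f Z W (h : hom (D ⊗ (E ⊗ Z)) (A ⊗ W)) :
  act2 f h
  = act (tens_comonoid d e) a f (h ∘ assoc D E Z) ∘ assoc_inv D E Z.
Proof.
apply heq_eq.
unfold act2, act, cop2, br; simpl; strict.
Qed.

Lemma assoc_invK X Y Z : assoc_inv X Y Z ∘ assoc X Y Z = idm ((X ⊗ Y) ⊗ Z).
Proof. apply heq_eq; strict. Qed.

Lemma act2_conv f g Z W (h : hom (D ⊗ (E ⊗ Z)) (A ⊗ W)) :
  act2 (conv (tens_comonoid d e) a f g) h = act2 f (act2 g h).
Proof.
rewrite !act2_act, act_conv by (try apply tens_comonoid_is_comonoid; assumption).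
now rewrite <- (comp_assoc _ (assoc_inv D E Z)), assoc_invK, comp_idr.
Qed.

Lemma act_op2_precomp F (c : comonoid_ops F) (k : hom (D ⊗ E) F) (f : hom F A)
    Z W (h : hom (F ⊗ Z) (A ⊗ W)) :
  is_comonoid_morphism (tens_comonoid d e) c k ->
  act c a f h ∘ op2 k Z = act2 (f ∘ k) (h ∘ op2 k Z).
Proof.
intros hk; rewrite act2_act; unfold op2 at 1; fold (k ▷ Z).
rewrite comp_assoc, (act_precomp _ _ _ hk); f_equal; f_equal.
unfold op2; now rewrite <- !comp_assoc, assoc_invK, comp_idr.
Qed.

(** [q ⊗ ε], up to the strict identifications. *)
Definition tens_counit : hom (D ⊗ E) D := unitr D ∘ (idm D ⊗m counit e).

Lemma op2_tens_counit (q : hom D A) Z :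
  op2 (q ∘ tens_counit) Z = (q ▷ Z) ∘ (D ◁ cu (counit e) Z).
Proof. unfold tens_counit; apply heq_eq; strict. Qed.

(** The copy of [E] fed to [q ∘ tens_counit] is erased by the counit, so only [D] is duplicated. *)
Lemma act2_tens_counit (q : hom D A) Z W (h : hom (D ⊗ (E ⊗ Z)) (A ⊗ W)) :
  act2 (q ∘ tens_counit) h = act d a q h.
Proof.
unfold act2, act; rewrite op2_tens_counit; unfold cop2; nf.
slide (cu_nat (counit e) h).
slide (cu_br D (counit e) (E ⊗ Z)).
slide (eq_sym (cop_nat (coprod d) (cu (counit e) (E ⊗ Z)))).
slide (cul_cop Z he).
reflexivity.
Qed.

Lemma tens_counit_morphism :
  is_comonoid_morphism (tens_comonoid d e) d tens_counit.
Proof.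
unfold tens_counit; split; simpl.
- apply rw_faithful, heq_eq; strict.
- apply rw_faithful.
  via (cop (coprod d) unit_obj ∘ (D ◁ cu (counit e) unit_obj)); [strict|].
  refine (heq_trans (g := (D ◁ cu (counit e) (D ⊗ unit_obj))
    ∘ (D ◁ E ◁ D ◁ cu (counit e) unit_obj) ∘ cop2 d e unit_obj) _ _);
    [|unfold cop2, br; strict].
  unfold cop2; nf.
  slide (cu_nat (counit e) (D ◁ cu (counit e) unit_obj)).
  slide (cu_br D (counit e) (E ⊗ unit_obj)).
  slide (eq_sym (cop_nat (coprod d) (cu (counit e) (E ⊗ unit_obj)))).
  slide (cul_cop unit_obj he).
  slide (cop_nat (coprod d) (cu (counit e) unit_obj)).
  apply heq_refl.
Qed.

End TensorAction.

(** * Antipodes as convolution inverses *)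

Section Antipode.
Variable C : strict_braided_monoidal_category.
Variables (H : C) (a : monoid_ops H) (d : comonoid_ops H) (S : hom H H).
Hypothesis hH : is_hopf_monoid a d S.

Lemma conv_antipode D (e : comonoid_ops D) (k : hom D H) :
  is_comonoid_morphism e d k ->
  conv e a k (S ∘ k) = conv1 e a /\ conv e a (S ∘ k) k = conv1 e a.
Proof.
intros hk; destruct hH as [_ [h1 h2]]; split.
- rewrite <- (conv1_precomp a hk); unfold conv1; rewrite <- h1.
  change (conv e a k (S ∘ k) = conv d a (idm H) S ∘ k).
  now rewrite (conv_precomp a _ _ hk), comp_idl.
- rewrite <- (conv1_precomp a hk); unfold conv1; rewrite <- h2.
  change (conv e a (S ∘ k) k = conv d a S (idm H) ∘ k).
  now rewrite (conv_precomp a _ _ hk), comp_idl.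
Qed.

(** Both composites are convolution inverses of [f], the first because [f] preserves products and
    units, the second because it preserves coproducts and counits. *)
Lemma hopf_morphism_antipode H' (a' : monoid_ops H') (d' : comonoid_ops H') S'
    (f : hom H H') :
  is_hopf_monoid a' d' S' -> is_monoid_morphism a a' f ->
  is_comonoid_morphism d d' f -> f ∘ S = S' ∘ f.
Proof.
intros hH' hf hf'; pose proof hH as [(_ & hd & _) [_ hS]].
pose proof hH' as [(ha' & _) [hS' _]].
apply (@conv_inverse_unique C H H' d a' hd ha' (f ∘ S) f (S' ∘ f)).
- rewrite <- (conv1_postcomp d hf); unfold conv1; rewrite <- hS.
  change (conv d a' (f ∘ S) f = f ∘ conv d a S (idm H)).
  now rewrite (conv_postcomp d _ _ hf), comp_idr.
- rewrite <- (conv1_precomp a' hf'); unfold conv1; rewrite <- hS'.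
  change (conv d a' f (S' ∘ f) = conv d' a' (idm H') S' ∘ f).
  now rewrite (conv_precomp a' _ _ hf'), comp_idl.
Qed.

End Antipode.

(** * From a Hopf truss to a module monoid and a cocycle *)

Section Truss.
Variable C : strict_braided_monoidal_category.
Variables (H : C) (a : monoid_ops H) (d : comonoid_ops H) (m2 : hom (H ⊗ H) H)
  (S s : hom H H).
Hypotheses (hH : is_hopf_monoid a d S) (hs : is_comonoid_morphism d d s).
Implicit Types X Y Z W : C.

Local Notation m := (mon_mul a).
Local Notation u := (mon_unit a).
Local Notation δ := (coprod d).
Local Notation ε := (counit d).
Local Notation Γ := (Gamma a m2 d S s).

Let ha : is_monoid a := proj1 (proj1 hH).
Let hd : is_comonoid d := proj1 (proj2 (proj1 hH)).

Lemma op2_Gamma Z : op2 Γ Z = act d a (S ∘ s) (op2 m2 Z).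
Proof. unfold Gamma, act; apply heq_eq; strict. Qed.

(** [Γ] is [S ∘ s] convolved with [m2], and [s] cancels [S ∘ s]. This is the cocycle condition for
    [π = id] and [θ = s]. *)
Lemma op2_Gamma_cocycle Z : act d a s (op2 Γ Z) = op2 m2 Z.
Proof.
rewrite op2_Gamma, <- act_conv by assumption.
rewrite (proj1 (conv_antipode hH hs)); now apply act_conv1.
Qed.

Lemma Gamma_cocycle :
  m2 = m ∘ (s ⊗m Γ) ∘ assoc H H H ∘ (δ ⊗m idm H).
Proof.
apply rw_faithful.
via (op2 m2 unit_obj); [strict|].
rewrite <- op2_Gamma_cocycle; unfold act.
(* Naming [Γ] makes [strict] treat it as a single generator. *)
set (G := Γ). strict.
Qed.

(** The cocycle condition determines the action: convolving it on the left with [S ∘ s] cancels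
    [s]. *)
Lemma Gamma_eq_of_cocycle (phi : hom (H ⊗ H) H) :
  m2 = m ∘ (s ⊗m phi) ∘ assoc H H H ∘ (δ ⊗m idm H) -> Γ = phi.
Proof.
intros e; apply rw_faithful.
via (op2 Γ unit_obj); [set (G := Γ); strict|].
rewrite op2_Gamma.
replace (op2 m2 unit_obj) with (act d a s (op2 phi unit_obj)).
- rewrite <- act_conv by assumption.
  rewrite (proj2 (conv_antipode hH hs)), act_conv1 by assumption; strict.
- rewrite e; unfold act; apply heq_eq; strict.
Qed.

Hypothesis hm2 : is_nonunital_bimonoid d m2.
Hypothesis compat :
  m2 ∘ (idm H ⊗m m) = m ∘ (m2 ⊗m Γ) ∘ mid_braid H H H H ∘ (δ ⊗m idm (H ⊗ H)).

Lemma op2_compat Z :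
  op2 m2 Z ∘ (H ◁ op2 m Z)
  = op2 m Z ∘ op2 m2 (H ⊗ Z) ∘ (H ◁ H ◁ op2 Γ Z) ∘ (H ◁ br H H (H ⊗ Z))
      ∘ cop δ (H ⊗ (H ⊗ Z)).
Proof.
via ((m2 ∘ (idm H ⊗m m)) ▷ Z); [strict|].
rewrite compat; unfold br; set (G := Γ); strict.
Qed.

(** Left convolution of the compatibility condition with [S ∘ s] turns the [m2] on the left and the
    first factor [m2] on the right into [Γ]. *)
Lemma op2_Gamma_mul Z :
  op2 Γ Z ∘ (H ◁ op2 m Z)
  = op2 m Z ∘ op2 Γ (H ⊗ Z) ∘ (H ◁ H ◁ op2 Γ Z) ∘ (H ◁ br H H (H ⊗ Z))
      ∘ cop δ (H ⊗ (H ⊗ Z)).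
Proof.
rewrite (op2_Gamma Z) at 1.
rewrite <- act_lw, op2_compat, (op2_Gamma (H ⊗ Z)), <- !comp_assoc.
rewrite act_op2 by assumption; f_equal.
rewrite !comp_assoc, act_cop by assumption.
now rewrite !act_lw.
Qed.

Let eta_morphism : is_comonoid_morphism (unit_comonoid C) d u :=
  proj1 (proj2 (proj2 (proj1 hH))).

Lemma cop_un Z : cop δ Z ∘ un u Z = un u (H ⊗ Z) ∘ un u Z.
Proof.
destruct eta_morphism as [_ h]; simpl in h.
via ((δ ∘ u) ▷ Z); [strict|rewrite h; strict].
Qed.

Lemma cu_un Z : cu ε Z ∘ un u Z = idm Z.
Proof.
destruct eta_morphism as [h _]; simpl in h.
via ((ε ∘ u) ▷ Z); [strict|rewrite h; strict].
Qed.

(** [m2 (x ⊗ 1)]; this turns out to be [s]. *)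
Definition mul2_unit : hom H H :=
  m2 ∘ (idm H ⊗m u) ∘ eqm (eq_sym (tens1r H)).

Lemma rw_mul2_unit Z : mul2_unit ▷ Z = op2 m2 Z ∘ (H ◁ un u Z).
Proof. unfold mul2_unit; apply heq_eq; strict. Qed.

(** [m2] is a comonoid morphism, and so is [x ↦ x ⊗ 1], since the unit is group-like. Hence
    [mul2_unit] is convolution invertible, which is what [sigma_eq_mul2_unit] needs. *)
Lemma mul2_unit_morphism : is_comonoid_morphism d d mul2_unit.
Proof.
destruct hm2 as (_ & _ & hmor).
unfold mul2_unit; rewrite <- comp_assoc.
apply (comonoid_morphism_comp hmor); split; simpl.
- apply rw_faithful.
  via (cu ε unit_obj ∘ (H ◁ (cu ε unit_obj ∘ un u unit_obj))); [strict|].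
  rewrite cu_un; strict.
- apply rw_faithful.
  via (cop2 d d unit_obj ∘ (H ◁ un u unit_obj)); [unfold cop2, br; strict|].
  unfold cop2; nf.
  slide (cop_un unit_obj).
  slide (cop_nat δ (un u (H ⊗ unit_obj))).
  slide (br_un H u (H ⊗ unit_obj)).
  slide (cop_nat δ (un u unit_obj)).
  strict.
Qed.

(** Put [t x = x ∘ 1]. Compatibility at [1 · 1] says that [t] is the convolution of [t], [S ∘ s] and
    [t]. Cancelling the invertible [t] leaves [S ∘ s] convolved with [t] equal to the convolution
    unit, so [t = s]. *)
Lemma sigma_eq_mul2_unit : s = mul2_unit.
Proof.
assert (e : mul2_unit
    = conv d a mul2_unit (conv d a (S ∘ s) mul2_unit)).
{ apply rw_faithful; rewrite !rw_conv, rw_mul2_unit.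
  (* The unit is written as [1 · 1] so that the compatibility condition applies. *)
  transitivity (op2 m2 unit_obj ∘ (H ◁ op2 m unit_obj)
    ∘ (H ◁ un u (H ⊗ unit_obj)) ∘ (H ◁ un u unit_obj)).
  { nf. slide (op2_unl unit_obj ha). reflexivity. }
  rewrite op2_compat; nf.
  slide (cop_nat δ (un u (H ⊗ unit_obj))).
  slide (br_un H u (H ⊗ unit_obj)).
  slide (cop_nat δ (un u unit_obj)).
  slide (eq_sym (un_nat u (op2 Γ unit_obj))).
  rewrite act_lw, <- op2_Gamma; unfold act; rewrite rw_mul2_unit; nf.
  reflexivity. }
destruct (conv_antipode hH mul2_unit_morphism) as [_ e1].
destruct (conv_antipode hH hs) as [e2 _].
assert (e3 : conv d a (S ∘ s) mul2_unit = conv1 d a).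
{ rewrite <- e1 at 1; rewrite e at 3.
  now rewrite <- conv_assoc, e1, conv_1l by assumption. }
rewrite <- (conv_1r hd ha s), <- e3, <- conv_assoc by assumption.
now rewrite e2, conv_1l by assumption.
Qed.

Lemma rw_sigma Z : s ▷ Z = op2 m2 Z ∘ (H ◁ un u Z).
Proof. rewrite sigma_eq_mul2_unit; apply rw_mul2_unit. Qed.

(** With [x ∘ 1 = σ x], the value [Γ_x 1] is [S σ] convolved with [σ]. *)
Lemma op2_Gamma_un Z : op2 Γ Z ∘ (H ◁ un u Z) = un u Z ∘ cu ε Z.
Proof.
rewrite op2_Gamma, <- act_lw, <- rw_sigma, <- rw_conv.
now rewrite (proj2 (conv_antipode hH hs)), rw_conv1.
Qed.

Lemma op2_faithful (f g : hom (H ⊗ H) H) :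
  (forall Z, op2 f Z = op2 g Z) -> f = g.
Proof.
intros e; apply rw_faithful.
via (op2 f unit_obj); [strict|rewrite e; strict].
Qed.

Lemma op2_conv (f g : hom (H ⊗ H) H) Z :
  op2 (conv (tens_comonoid d d) a f g) Z = act2 d d a f (op2 g Z).
Proof. unfold conv, act2, cop2, br; apply heq_eq; simpl; strict. Qed.

Lemma op2_Gamma_rw (k : hom H H) Z :
  op2 (Γ ∘ (idm H ⊗m k)) Z = op2 Γ Z ∘ (H ◁ (k ▷ Z)).
Proof. apply heq_eq; set (G := Γ); strict. Qed.

(** In elements, [Γ_x (f(y1) · h(y2 ⊗ z)) = Γ_{x1} (f y1) · Γ_{x2} (h(y2 ⊗ z))]. As [Gamma_conv] and
    [Gamma_conv1] record, [f ↦ Γ ∘ (H ⊗ f)] is thus a morphism of convolution algebras. *)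
Lemma op2_Gamma_act (f : hom H H) Z W (h : hom (H ⊗ Z) (H ⊗ W)) :
  op2 Γ W ∘ (H ◁ act d a f h)
  = act2 d d a (Γ ∘ (idm H ⊗m f)) (op2 Γ W ∘ (H ◁ h)).
Proof.
unfold act2, act, cop2; rewrite op2_Gamma_rw; nf.
slide (op2_Gamma_mul W).
slide (cop_nat δ (f ▷ (H ⊗ W))).
slide (br_natr H (H ⊗ W) f).
slide (rw_nat f (op2 Γ W)).
slide (cop_nat δ (H ◁ h)).
slide (br_nat H H h).
reflexivity.
Qed.

Lemma Gamma_conv (f g : hom H H) :
  conv (tens_comonoid d d) a (Γ ∘ (idm H ⊗m f)) (Γ ∘ (idm H ⊗m g))
  = Γ ∘ (idm H ⊗m conv d a f g).
Proof.
apply op2_faithful; intros Z.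
now rewrite op2_conv, !op2_Gamma_rw, rw_conv, op2_Gamma_act.
Qed.

Lemma Gamma_conv1 :
  Γ ∘ (idm H ⊗m conv1 d a) = conv1 (tens_comonoid d d) a.
Proof.
apply op2_faithful; intros Z.
rewrite op2_Gamma_rw, rw_conv1, lw_comp, comp_assoc, op2_Gamma_un.
unfold conv1; apply heq_eq; simpl; strict.
Qed.

(** As [σ] is right multiplication by the unit, associativity of [m2] gives [σ(x ∘ y) = x ∘ σ y],
    which the cocycle condition expands to [σ x1 · Γ_{x2} (σ y)]. *)
Lemma sigma_mul2 :
  s ∘ m2
  = conv (tens_comonoid d d) a (s ∘ tens_counit H d) (Γ ∘ (idm H ⊗m s)).
Proof.
apply op2_faithful; intros Z.
rewrite op2_conv, (act2_tens_counit d a hd), op2_Gamma_rw, act_lw, op2_Gamma_cocycle.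
transitivity ((s ▷ Z) ∘ op2 m2 Z); [apply heq_eq; strict|].
rewrite !rw_sigma; nf.
slide (eq_sym (op2_nat m2 (un u Z))).
slide (op2_assoc Z (proj1 (proj2 hm2))).
reflexivity.
Qed.

(** Reading [Γ (x ⊗ S (σ y)) S (σ x)] as the convolution inverse of
    [σ (m2 (x ⊗ y))] is what makes [Γ] compatible with [m2]. *)
Lemma antipode_sigma_mul2 :
  conv (tens_comonoid d d) a (Γ ∘ (idm H ⊗m (S ∘ s)))
    ((S ∘ s) ∘ tens_counit H d)
  = S ∘ (s ∘ m2).
Proof.
pose proof (tens_comonoid_is_comonoid hd hd) as hdd.
destruct (conv_antipode hH (comonoid_morphism_comp hs (proj2 (proj2 hm2))))
  as [e _].
apply (conv_inverse_unique hdd ha (g := s ∘ m2)); [|exact e].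
rewrite sigma_mul2, conv_assoc, <- (conv_assoc hdd ha (_ ∘ tens_counit H d))
  by assumption.
rewrite <- (conv_precomp a _ _ (tens_counit_morphism d hd)).
rewrite (proj2 (conv_antipode hH hs)).
rewrite (conv1_precomp a (tens_counit_morphism d hd)), conv_1l by assumption.
now rewrite Gamma_conv, (proj2 (conv_antipode hH hs)), Gamma_conv1.
Qed.

Lemma op2_Gamma_module Z :
  op2 Γ Z ∘ (H ◁ op2 Γ Z) = op2 Γ Z ∘ op2 m2 (H ⊗ Z).
Proof.
rewrite (op2_Gamma Z) at 2; rewrite op2_Gamma_act.
rewrite op2_Gamma, <- act_lw, (op2_assoc Z (proj1 (proj2 hm2))).
(* Since [m2] is a comonoid morphism, [Γ_{x ∘ y}] becomes one convolution over [H ⊗ H] with factor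
   [S σ m2]; the two leading factors on the other side are then merged to match it. *)
rewrite (act_op2_precomp a _ _ (proj2 (proj2 hm2))).
rewrite <- (act2_tens_counit d a hd), <- act2_conv by assumption.
now rewrite antipode_sigma_mul2, comp_assoc.
Qed.

Lemma Gamma_module_monoid :
  @is_nonunital_module_monoid C (NonunitalBimonoid hm2) H a Γ.
Proof.
unfold is_nonunital_module_monoid, is_nonunital_module; simpl.
repeat split; apply rw_faithful.
- via (op2 Γ unit_obj ∘ (H ◁ op2 Γ unit_obj)); [set (G := Γ); strict|].
  rewrite op2_Gamma_module; set (G := Γ); strict.
- via (op2 Γ unit_obj ∘ (H ◁ un u unit_obj)); [set (G := Γ); strict|].
  rewrite op2_Gamma_un, <- (cu_nat ε); strict.
- via (op2 Γ unit_obj ∘ (H ◁ op2 m unit_obj)); [set (G := Γ); strict|].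
  rewrite op2_Gamma_mul; unfold br; set (G := Γ); strict.
Qed.

End Truss.

(** * Transport of a cocycle to a truss on its target *)

Section Transport.
Variable C : strict_braided_monoidal_category.
Implicit Types W X Y Z D E : C.

Lemma mid_braid_natural W X Y Z W' X' Y' Z' (w : hom W W') (x : hom X X')
    (y : hom Y Y') (z : hom Z Z') :
  mid_braid W' X' Y' Z' ∘ ((w ⊗m x) ⊗m (y ⊗m z))
  = ((w ⊗m y) ⊗m (x ⊗m z)) ∘ mid_braid W X Y Z.
Proof.
unfold mid_braid; rewrite <- !comp_assoc.
via (((idm W' ⊗m braid X' Y') ⊗m idm Z') ∘ ((w ⊗m (x ⊗m y)) ⊗m z)).
- apply heq_eqm_comp, heq_comp; [apply heq_refl|].
  apply heq_eqm_comp; heq_layer.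
- rewrite <- !tensm_comp, braid_natural, comp_idl.
  replace ((w ⊗m ((y ⊗m x) ∘ braid X Y)) ⊗m (idm Z' ∘ z))
    with (((w ⊗m (y ⊗m x)) ⊗m z) ∘ ((idm W ⊗m braid X Y) ⊗m idm Z))
    by (now rewrite <- !tensm_comp, comp_idl, !comp_idr).
  apply heq_comp; [heq_layer|].
  apply heq_sym, heq_eqm_comp, heq_comp_eqm, heq_refl.
Qed.

Lemma tens_comonoid_morphism D E D' E' (d : comonoid_ops D) (e : comonoid_ops E)
    (d' : comonoid_ops D') (e' : comonoid_ops E') (f : hom D D') (g : hom E E') :
  is_comonoid_morphism d d' f -> is_comonoid_morphism e e' g ->
  is_comonoid_morphism (tens_comonoid d e) (tens_comonoid d' e') (f ⊗m g).
Proof.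
intros [f0 f1] [g0 g1]; split; simpl.
- now rewrite <- comp_assoc, <- tensm_comp, f0, g0.
- now rewrite <- comp_assoc, <- tensm_comp, f1, g1, tensm_comp, comp_assoc,
    mid_braid_natural, comp_assoc.
Qed.

Lemma comonoid_morphism_inverse D E (d : comonoid_ops D) (e : comonoid_ops E)
    (f : hom D E) (g : hom E D) :
  g ∘ f = idm D -> f ∘ g = idm E ->
  is_comonoid_morphism d e f -> is_comonoid_morphism e d g.
Proof.
intros gf fg [f0 f1]; split.
- now rewrite <- f0, <- comp_assoc, fg, comp_idr.
- transitivity ((g ⊗m g) ∘ ((f ⊗m f) ∘ coprod d) ∘ g).
  + now rewrite comp_assoc, <- tensm_comp, gf, tensm_id, comp_idl.
  + now rewrite <- f1, <- !comp_assoc, fg, comp_idr.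
Qed.

(** Converse to the passage in [op2_Gamma_mul]: left convolution of the module monoid law with [s]
    turns the [phi] on the left and the first factor on the right into [m2]. *)
Lemma module_monoid_compat (H : C) (a : monoid_ops H) (d : comonoid_ops H)
    (m2 phi : hom (H ⊗ H) H) (s : hom H H) :
  is_comonoid d -> is_monoid a ->
  m2 = mon_mul a ∘ (s ⊗m phi) ∘ assoc H H H ∘ (coprod d ⊗m idm H) ->
  phi ∘ (idm H ⊗m mon_mul a)
    = mon_mul a ∘ (phi ⊗m phi) ∘ mid_braid H H H H
        ∘ (coprod d ⊗m idm (H ⊗ H)) ->
  m2 ∘ (idm H ⊗m mon_mul a)
    = mon_mul a ∘ (m2 ⊗m phi) ∘ mid_braid H H H H
        ∘ (coprod d ⊗m idm (H ⊗ H)).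
Proof.
intros hd ha cocycle hphi.
assert (op2_cocycle : forall Z, op2 m2 Z = act d a s (op2 phi Z)).
{ intros Z; rewrite cocycle; unfold act; apply heq_eq; strict. }
assert (op2_phi : forall Z, op2 phi Z ∘ (H ◁ op2 (mon_mul a) Z)
  = op2 (mon_mul a) Z ∘ op2 phi (H ⊗ Z) ∘ (H ◁ H ◁ op2 phi Z)
      ∘ (H ◁ br H H (H ⊗ Z)) ∘ cop (coprod d) (H ⊗ (H ⊗ Z))).
{ intros Z; via ((phi ∘ (idm H ⊗m mon_mul a)) ▷ Z); [strict|].
  rewrite hphi; unfold br; strict. }
apply rw_faithful.
via (op2 m2 unit_obj ∘ (H ◁ op2 (mon_mul a) unit_obj)); [strict|].
rewrite op2_cocycle, <- act_lw, op2_phi, <- !comp_assoc.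
rewrite act_op2 by assumption.
rewrite !comp_assoc, act_cop by assumption.
rewrite !act_lw, <- op2_cocycle; unfold br; strict.
Qed.

Section TrussOfCocycle.
Variable p : gen_inv_cocycle C.

Local Notation B := (gic_B p).
Local Notation H := (gic_H p).
Local Notation π := (gic_pi p).
Local Notation φ := (gic_phi p).
Local Notation a := (hm_monoid H).
Local Notation d := (hm_comonoid H).

(** Invertibility of [π] is a bare existence statement, so the inverse has to be chosen; being
    unique, it does not depend on the choice. *)
Definition gic_pi_inv : hom H B :=
  proj1_sig (constructive_indefinite_description _ (gic_pi_iso p)).

Local Notation q := gic_pi_inv.

Lemma gic_pi_invl : q ∘ π = idm (nb_obj B).
Proof.
exact (proj1 (proj2_sig (constructive_indefinite_description _ (gic_pi_iso p)))).
Qed.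

Lemma gic_pi_invr : π ∘ q = idm (hm_obj H).
Proof.
exact (proj2 (proj2_sig (constructive_indefinite_description _ (gic_pi_iso p)))).
Qed.

Lemma gic_pi_inv_comonoid : is_comonoid_morphism d (nb_comonoid B) q.
Proof.
exact (comonoid_morphism_inverse gic_pi_invl gic_pi_invr (gic_pi_comonoid p)).
Qed.

Definition gic_mul2 : hom (H ⊗ H) H := π ∘ nb_mul B ∘ (q ⊗m q).
Definition gic_sigma : hom H H := π ∘ gic_theta p ∘ q.
Definition gic_action : hom (H ⊗ H) H := φ ∘ (q ⊗m idm H).

Lemma gic_sigma_comonoid : is_comonoid_morphism d d gic_sigma.
Proof.
exact (comonoid_morphism_comp
  (comonoid_morphism_comp (gic_pi_comonoid p) (gic_theta_comonoid p))
  gic_pi_inv_comonoid).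
Qed.

Lemma pi_multiplicative : is_multiplicative (nb_mul B) gic_mul2 π.
Proof.
unfold is_multiplicative, gic_mul2.
now rewrite <- comp_assoc, <- tensm_comp, gic_pi_invl, tensm_id, comp_idr.
Qed.

Lemma gic_pi_inv_multiplicative : is_multiplicative gic_mul2 (nb_mul B) q.
Proof.
unfold is_multiplicative, gic_mul2.
now rewrite !comp_assoc, gic_pi_invl, comp_idl.
Qed.

Lemma gic_mul2_bimonoid : is_nonunital_bimonoid d gic_mul2.
Proof.
destruct (nb_axioms B) as (_ & hassoc & hmul).
split; [exact (proj1 (proj2 (proj1 (hm_axioms H))))|split].
- unfold associative_product in *.
  transitivity (π ∘ (nb_mul B ∘ (idm B ⊗m nb_mul B) ∘ assoc B B B)
    ∘ ((q ⊗m q) ⊗m q)).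
  + assert (e : assoc B B B ∘ ((q ⊗m q) ⊗m q)
        = (q ⊗m (q ⊗m q)) ∘ assoc H H H) by apply tensmA.
    rewrite <- !comp_assoc, e; unfold gic_mul2 at 1.
    rewrite <- !comp_assoc; do 2 f_equal; rewrite !comp_assoc; f_equal.
    rewrite <- !tensm_comp, comp_idl, comp_idr.
    f_equal; exact gic_pi_inv_multiplicative.
  + rewrite hassoc; unfold gic_mul2 at 1.
    rewrite <- !comp_assoc; do 2 f_equal.
    rewrite <- !tensm_comp, comp_idl, comp_idr.
    f_equal; symmetry; exact gic_pi_inv_multiplicative.
- exact (comonoid_morphism_comp
    (comonoid_morphism_comp (gic_pi_comonoid p) hmul)
    (tens_comonoid_morphism gic_pi_inv_comonoid gic_pi_inv_comonoid)).
Qed.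

(** This is the cocycle condition precomposed with [q ⊗ q]; the coproduct passes [q] and the
    remaining [π ∘ q] is an identity. *)
Lemma gic_mul2_cocycle :
  gic_mul2 = mon_mul a ∘ (gic_sigma ⊗m gic_action) ∘ assoc H H H
               ∘ (coprod d ⊗m idm H).
Proof.
unfold gic_mul2, gic_action, gic_sigma; rewrite gic_cocycle.
assert (e : assoc B B H ∘ ((q ⊗m q) ⊗m idm H)
    = (q ⊗m (q ⊗m idm H)) ∘ assoc H H H) by apply tensmA.
rewrite tensm_comp, <- !comp_assoc; do 2 f_equal.
rewrite (comp_assoc (q ⊗m (q ⊗m idm _))), <- e, <- !comp_assoc, <- !tensm_comp.
now rewrite gic_pi_invr, comp_idl, (proj2 gic_pi_inv_comonoid).
Qed.

Lemma gic_action_mul :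
  gic_action ∘ (idm H ⊗m mon_mul a)
  = mon_mul a ∘ (gic_action ⊗m gic_action) ∘ mid_braid H H H H
      ∘ (coprod d ⊗m idm (H ⊗ H)).
Proof.
destruct (gic_phi_module p) as (_ & _ & h).
transitivity ((φ ∘ (idm B ⊗m mon_mul a)) ∘ (q ⊗m idm (H ⊗ H))).
- unfold gic_action; rewrite <- !comp_assoc, <- !tensm_comp.
  now rewrite !comp_idl, !comp_idr.
- rewrite h; unfold gic_action; rewrite tensm_comp, <- !comp_assoc; do 2 f_equal.
  rewrite !comp_assoc, <- mid_braid_natural, <- !comp_assoc, <- !tensm_comp.
  now rewrite tensm_id, !comp_idl, (proj2 gic_pi_inv_comonoid).
Qed.

Lemma gic_Gamma :
  Gamma a gic_mul2 d (hm_antipode H) gic_sigma = gic_action.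
Proof.
exact (Gamma_eq_of_cocycle (hm_axioms H) gic_sigma_comonoid gic_mul2_cocycle).
Qed.

Lemma gic_compat :
  gic_mul2 ∘ (idm H ⊗m mon_mul a)
  = mon_mul a
      ∘ (gic_mul2 ⊗m Gamma a gic_mul2 d (hm_antipode H) gic_sigma)
      ∘ mid_braid H H H H ∘ (coprod d ⊗m idm (H ⊗ H)).
Proof.
rewrite gic_Gamma.
destruct (hm_axioms H) as [(ha & hd & _) _].
exact (module_monoid_compat hd ha gic_mul2_cocycle gic_action_mul).
Qed.

Definition truss_of_gic : hopf_truss C :=
  HopfTruss (hm_axioms H) gic_mul2_bimonoid gic_sigma_comonoid gic_compat.

End TrussOfCocycle.

Definition gic_of_truss (T : hopf_truss C) : gen_inv_cocycle C.
Proof.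
refine (@GenInvCocycle C (ht_H2 T) (ht_H1 T)
  (Gamma (ht_monoid T) (ht_mul2 T) (ht_comonoid T) (ht_antipode T) (ht_sigma T))
  (idm (ht_obj T)) (ht_sigma T) _ (comonoid_morphism_id _) _
  (ht_sigma_comonoid T) _).
- exact (Gamma_module_monoid (ht_axioms1 T) (ht_sigma_comonoid T)
    (ht_axioms2 T) (ht_compat T)).
- exists (idm (ht_obj T)); split; apply comp_idl.
- rewrite !comp_idl.
  exact (Gamma_cocycle (ht_mul2 T) (ht_axioms1 T) (ht_sigma_comonoid T)).
Defined.
End Transport.

(** * The two functors and the comparison isomorphisms *)

Section Functors.
Variable C : strict_braided_monoidal_category.

Lemma truss_morphism_of_gic (p p' : gen_inv_cocycle C) (fg : GIC_hom p p') :
  @is_hopf_truss_morphism C (truss_of_gic p) (truss_of_gic p')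
    (snd (proj1_sig fg)).
Proof.
destruct fg as [[f g] h]; simpl; destruct h as (hf & hg & _ & e & _).
split; [exact hg|split; [|exact (proj2 hg)]].
(* The square [g ∘ π = π' ∘ f] is inverted, so that [g] respects the transported products. *)
assert (e' : f ∘ gic_pi_inv p = gic_pi_inv p' ∘ g).
{ transitivity (gic_pi_inv p' ∘ (gic_pi p' ∘ f) ∘ gic_pi_inv p).
  - now rewrite comp_assoc, gic_pi_invl, comp_idl.
  - now rewrite <- e, <- !comp_assoc, gic_pi_invr, comp_idr. }
change (g ∘ gic_mul2 p = gic_mul2 p' ∘ (g ⊗m g)); unfold gic_mul2.
rewrite !comp_assoc, e, <- (comp_assoc (gic_pi p') f), (proj1 hf).
now rewrite <- !comp_assoc, <- !tensm_comp, e'.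
Qed.

Definition gic_to_truss : functor (GIC C) (HTr C).
Proof.
refine (@Functor (GIC C) (HTr C) (@truss_of_gic C)
  (fun p p' fg => exist _ (snd (proj1_sig fg)) (truss_morphism_of_gic fg)) _ _);
  intros; apply HTr_hom_eq; reflexivity.
Defined.

(** A truss morphism is not assumed to respect [σ] or [Γ]. It respects [σ] because [σ x = x ∘ 1],
    and then [Γ], which is built from the antipode, [σ], the products and the coproduct. *)
Lemma gic_morphism_of_truss (T T' : hopf_truss C) (f : HTr_hom T T') :
  @is_gic_morphism C (gic_of_truss T) (gic_of_truss T')
    (proj1_sig f, proj1_sig f).
Proof.
destruct f as [f h]; simpl; destruct h as [[[hu hm] hc] [hm2 _]]; simpl in *.
unfold is_multiplicative in hm, hm2; destruct hc as [hc0 hc1].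
assert (hS : f ∘ ht_antipode T = ht_antipode T' ∘ f)
  by exact (hopf_morphism_antipode (ht_axioms1 T) (ht_axioms1 T')
             (conj hu hm) (conj hc0 hc1)).
assert (hs : f ∘ ht_sigma T = ht_sigma T' ∘ f).
{ apply rw_faithful.
  rewrite !rw_comp.
  rewrite (rw_sigma (ht_axioms1 T) (ht_sigma_comonoid T) (ht_axioms2 T)
    (ht_compat T)).
  rewrite (rw_sigma (ht_axioms1 T') (ht_sigma_comonoid T') (ht_axioms2 T')
    (ht_compat T')).
  rewrite comp_assoc, (op2_multiplicative _ hm2); nf.
  (* The second copy of [f] is absorbed into the unit, which [f] preserves. *)
  transitivity (op2 (ht_mul2 T') unit_obj ∘ (f ▷ (T' ⊗ unit_obj))
    ∘ (T ◁ un (f ∘ mon_unit (ht_monoid T)) unit_obj)).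
  { apply heq_eq; strict. }
  rewrite hu; nf. slide (rw_nat f (un (mon_unit (ht_monoid T')) unit_obj)).
  reflexivity. }
repeat split; try assumption.
- now rewrite comp_idl, comp_idr.
- unfold Gamma; rewrite !comp_assoc, hm.
  rewrite <- (comp_assoc _ (f ⊗m f)), <- tensm_comp, hm2.
  rewrite comp_assoc, hS, <- (comp_assoc _ f), hs, comp_assoc, tensm_comp.
  rewrite <- !comp_assoc; do 2 f_equal.
  assert (e : assoc T' T' T' ∘ ((f ⊗m f) ⊗m f) = (f ⊗m (f ⊗m f)) ∘ assoc T T T)
    by apply tensmA.
  rewrite comp_assoc, <- e, <- !comp_assoc, <- !tensm_comp.
  now rewrite hc1, comp_idl, comp_idr.
Qed.

Definition truss_to_gic : functor (HTr C) (GIC C).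
Proof.
refine (@Functor (HTr C) (GIC C) (@gic_of_truss C)
  (fun T T' f => exist _ (proj1_sig f, proj1_sig f) (gic_morphism_of_truss f))
  _ _);
  intros; apply GIC_hom_eq; reflexivity.
Defined.

Lemma gic_counit_morphism (p : gen_inv_cocycle C) :
  @is_gic_morphism C (gic_of_truss (truss_of_gic p)) p
    (gic_pi_inv p, idm (hm_obj (gic_H p))).
Proof.
split; [split|split; [|split; [|split]]]; simpl.
- apply gic_pi_inv_multiplicative.
- apply gic_pi_inv_comonoid.
- exact (hopf_morphism_id (gic_H p)).
- unfold gic_sigma; now rewrite !comp_assoc, gic_pi_invl, comp_idl.
- now rewrite gic_pi_invr, comp_idl.
- rewrite comp_idl; apply gic_Gamma.
Qed.

Lemma gic_counit_inverse_morphism (p : gen_inv_cocycle C) :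
  @is_gic_morphism C p (gic_of_truss (truss_of_gic p))
    (gic_pi p, idm (hm_obj (gic_H p))).
Proof.
split; [split|split; [|split; [|split]]]; simpl.
- apply pi_multiplicative.
- apply gic_pi_comonoid.
- exact (hopf_morphism_id (gic_H p)).
- unfold gic_sigma; now rewrite <- !comp_assoc, gic_pi_invl, comp_idr.
- reflexivity.
- rewrite comp_idl, gic_Gamma; unfold gic_action.
  now rewrite <- comp_assoc, <- tensm_comp, gic_pi_invl, comp_idl, tensm_id,
    comp_idr.
Qed.

(** The chosen inverse does not reduce, but its composite with [π = id] is the identity. *)
Lemma gic_pi_inv_of_truss (T : hopf_truss C) :
  gic_pi_inv (gic_of_truss T) = idm (ht_obj T).
Proof.
exact (eq_trans (eq_sym (comp_idl _)) (gic_pi_invr (gic_of_truss T))).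
Qed.

Lemma gic_mul2_of_truss (T : hopf_truss C) :
  gic_mul2 (gic_of_truss T) = ht_mul2 T.
Proof.
unfold gic_mul2; rewrite gic_pi_inv_of_truss; simpl.
now rewrite tensm_id, comp_idl, comp_idr.
Qed.

(** The round trip changes the second product only by conjugation with a chosen inverse of the
    identity, so the identity of the carrier is a truss morphism both ways. *)
Lemma truss_unit_morphism (T : hopf_truss C) :
  @is_hopf_truss_morphism C T (truss_of_gic (gic_of_truss T)) (idm (ht_obj T)) /\
  @is_hopf_truss_morphism C (truss_of_gic (gic_of_truss T)) T (idm (ht_obj T)).
Proof.
split; (split; [exact (hopf_morphism_id (ht_H1 T))|]);
  (split; [|apply comonoid_morphism_id]); simpl; rewrite gic_mul2_of_truss;
  apply multiplicative_id.
Qed.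

End Functors.

Theorem theorem3p2 (C : strict_braided_monoidal_category) :
  equivalent_categories (GIC C) (HTr C).
Proof.
exists (gic_to_truss C), (truss_to_gic C); split.
(* The component at [p] is the pair of [π^-1] and the identity of [H], with inverse the pair of [π]
   and the identity. *)
- exists (fun p : GIC C =>
    exist _ _ (gic_counit_morphism p)
      : GIC_hom (gic_of_truss (truss_of_gic p)) p); split.
  + intros p; exists (exist _ _ (gic_counit_inverse_morphism p)).
    split; apply GIC_hom_eq; simpl; first
      [ apply gic_pi_invl | apply gic_pi_invr | apply comp_idl ].
  + intros p p' [[f g] h]; apply GIC_hom_eq; simpl; destruct h as (_ & _ & _ & e & _).
    (* The round trip sends the pair of [f] and [g] to the pair of [g] and [g], so naturality in the
       first component is the inverted square of [g ∘ π = π' ∘ f]. *)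
    * transitivity (gic_pi_inv p' ∘ (g ∘ gic_pi p) ∘ gic_pi_inv p).
      -- now rewrite <- !comp_assoc, gic_pi_invr, comp_idr.
      -- now rewrite e, comp_assoc, gic_pi_invl, comp_idl.
    * now rewrite comp_idl, comp_idr.
- exists (fun T : HTr C =>
    exist _ _ (proj2 (truss_unit_morphism T))
      : HTr_hom (truss_of_gic (gic_of_truss T)) T);
    split.
  + intros T; exists (exist _ _ (proj1 (truss_unit_morphism T))).
    split; apply HTr_hom_eq; apply comp_idl.
  + intros T T' f; apply HTr_hom_eq; simpl.
    now rewrite comp_idl, comp_idr.
Qed.
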